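(* Let $\Lambda\subset S^{n-1}$ be open, and let $A\subset\mathbb R^n$ be a continuously differentiable curve parametrized by $I\ni s\mapsto a(s)\in A$, where $I$ is an open interval. Let $U\subset\mathbb R^n$ be bounded, open and disjoint from $A$. Let $\widetilde D_0$ be the operator defined in the context using $A$ and $\Lambda$, with values in $\mathcal D'(I\times\Lambda_c)$. Assume that for each $\omega\in\Lambda$ there is an open (nonempty) interval $I_\omega\subset I$ such that for all $s\in I_\omega$ the ray $\{a(s)+t\omega:t\ge0\}$ misses $U$. If $\mu\in\mathcal E'(U)$ and $\widetilde D_0\mu=0$, then $\mu=0$ when restricted to the measured region $\{v+t\omega: v\in A,\ \omega\in\Lambda,\ t\ge0\}$ (i.e. $\mu$ vanishes as a distribution on the open set $U\cap\{v+t\omega:v\in A,\ \omega\in\Lambda,\ t\geq 0\}$).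
   Context: $\mathcal E'(U)$ is the space of distributions with compact support contained in $U$, and $\mathcal D'(Y)$ is the space of distributions on $Y$. Set $$\Lambda_c=\{x\in\mathbb R^n\setminus\{0\}: x/|x|\in\Lambda\}.$$ For $\mu\in C_c^\infty(U)$ and an integer $k\ge0$, $$\widetilde D_k\mu(s,x)=\int_0^\infty t^k\mu(a(s)+tx)\,dt,\qquad (s,x)\in I\times\Lambda_c .$$ For $h\in C_c^\infty(I\times\Lambda_c)$ the formal adjoint is $$\widetilde D_k^*h(y)=\int_I\int_0^\infty t^{k-n}\,h\Big(s,\frac{y-a(s)}{t}\Big)\,dt\,ds ,$$ and $\widetilde D_k$ is extended to $\mu\in\mathcal E'(U)$ by duality: $\langle\widetilde D_k\mu,h\rangle=\langle\mu,\widetilde D_k^*h\rangle$ for all $h\in C_c^\infty(I\times\Lambda_c)$. *)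

(* Defs.v *)
From HB Require Import structures.
From mathcomp Require Import all_boot all_order all_algebra.
From mathcomp Require Import all_classical all_reals all_analysis.
From mathcomp Require Import complex.
Set Implicit Arguments.
Unset Strict Implicit.
Unset Printing Implicit Defensive.
Import Order.TTheory GRing.Theory Num.Theory.
Import numFieldNormedType.Exports.
Local Open Scope classical_set_scope.
Local Open Scope ring_scope.

Section TestFunctions.
Context {R : realType} {W : normedModType R}.

(* iter_deriv [:: v1; ...; vk] f = D_{v1} (... (D_{vk} f)) *)
Definition iter_deriv (vs : seq W) (f : W -> R) : W -> R :=
  foldr (fun v g => fun x => 'D_v g x) f vs.

(* C^oo on O.  For finite-dimensional W, asking for all directions v instead
   of a basis is no stronger: continuous partials imply differentiability. *)
Definition smooth_real (O : set W) (f : W -> R) : Prop :=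
  forall (vs : seq W) (x : W), O x ->
    {for x, continuous (iter_deriv vs f)} /\
    forall v : W, derivable (iter_deriv vs f) x v.

Definition smooth_on (O : set W) (f : W -> R[i]) : Prop :=
  smooth_real O (fun x => complex.Re (f x)) /\
  smooth_real O (fun x => complex.Im (f x)).

Definition iter_derivC (vs : seq W) (f : W -> R[i]) (x : W) : R[i] :=
  (iter_deriv vs (fun y => complex.Re (f y)) x
   +i* iter_deriv vs (fun y => complex.Im (f y)) x)%C.

Definition fsupport (f : W -> R[i]) : set W := closure [set x | f x != 0].

(* C_c^oo(O), each element being extended by 0 to the whole space *)
Definition test_fun (O : set W) : set (W -> R[i]) :=
  [set f | [/\ smooth_on setT f, compact (fsupport f) & fsupport f `<=` O]].

(* functionals are only meaningful on test functions; nothing is asked of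
   their values elsewhere *)
Definition vanishes_on (O : set W) (mu : (W -> R[i]) -> R[i]) : Prop :=
  forall f, test_fun O f -> mu f = 0.

End TestFunctions.

Section Distributions.
Context {R : realType} {n : nat}.
Local Notation V := 'rV[R]_n.
Implicit Types (U : set V) (mu : (V -> R[i]) -> R[i]).

Definition basis_dir (i : 'I_n) : V := delta_mx 0 i.

(* all partial derivatives of f of order at most N are bounded by M *)
Definition CN_bounded (N : nat) (M : R) (f : V -> R[i]) : Prop :=
  forall (s : seq 'I_n) (x : V), (size s <= N)%N ->
    Normc.normc (iter_derivC (map basis_dir s) f x) <= M.

(* mu belongs to D'(U) *)
Definition schwartz_distribution U mu : Prop :=
  (forall (c : R[i]) (f g : V -> R[i]), test_fun U f -> test_fun U g ->
     mu (fun x => c * f x + g x) = c * mu f + mu g) /\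
  (forall K : set V, compact K -> K `<=` U ->
     exists (N : nat) (C : R), forall f, test_fun U f -> fsupport f `<=` K ->
       forall M : R, CN_bounded N M f -> Normc.normc (mu f) <= C * M).

(* complement in U of the union of the open sets on which mu vanishes *)
Definition dsupport U mu : set V :=
  [set x | U x /\ ~ exists O : set V,
     [/\ open O, O `<=` U, O x & vanishes_on O mu]].

(* mu belongs to E'(U) *)
Definition compact_distribution U mu : Prop :=
  schwartz_distribution U mu /\ compact (dsupport U mu).

(* chi in C_c^oo(U) equal to 1 in a neighbourhood of supp mu *)
Definition cutoff U mu : set (V -> R[i]) :=
  [set chi | test_fun U chi /\
     forall x, dsupport U mu x -> \forall y \near x, chi y = 1].

(* <mu, f> for mu in E'(U) and f smooth on U, namely mu (chi f) for a cutoff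
   chi; the value does not depend on chi, nor on f outside U. *)
Definition pairing U mu (f : V -> R[i]) : R[i] :=
  mu (fun y => xget (fun=> 0) (cutoff U mu) y * f y).

End Distributions.

Section DivergentBeam.
Context {R : realType} {n : nat}.
Local Notation V := 'rV[R]_n.

(* the norm of the library on 'rV is the sup norm *)
Definition enorm (x : V) : R := Num.sqrt (\sum_(i < n) x 0 i ^+ 2).

Definition unit_sphere : set V := [set x | enorm x = 1].

Definition cone (L : set V) : set V :=
  [set x | x != 0 /\ L ((enorm x)^-1 *: x)].

Definition integralC (D : set R) (f : R -> R[i]) : R[i] :=
  (\int[lebesgue_measure]_(t in D) complex.Re (f t)
   +i* \int[lebesgue_measure]_(t in D) complex.Im (f t))%C.

(* the formal adjoint \tilde D_k^* h *)
Definition beam_adjoint (k : nat) (I : set R) (a : R -> V)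
    (h : R * V -> R[i]) (y : V) : R[i] :=
  integralC I (fun s => integralC `]0, +oo[%classic (fun t =>
    (t ^ (k%:Z - n%:Z))%:C%C * h (s, t^-1 *: (y - a s)))).

(* \tilde D_k mu for mu in E'(U), as a functional on C_c^oo(I * cone L) *)
Definition beam (k : nat) (I : set R) (a : R -> V) (U : set V)
    (mu : (V -> R[i]) -> R[i]) (h : R * V -> R[i]) : R[i] :=
  pairing U mu (beam_adjoint k I a h).

Definition C1_on (I : set R) (a : R -> V) : Prop :=
  forall s, I s -> derivable a s 1 /\ {for s, continuous (derive1 a)}.

Definition ray (v w : V) : set V :=
  [set x | exists2 t : R, 0 <= t & x = v + t *: w].

Definition measured_region (A L : set V) : set V :=
  [set x | exists v w, [/\ A v, L w & ray v w x]].

End DivergentBeam.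

(* Main.v *)
Require Import Defs.
From HB Require Import structures.
From mathcomp Require Import all_boot all_order all_algebra.
From mathcomp Require Import all_classical all_reals all_analysis.
From mathcomp Require Import complex.
From mathcomp Require Import ring lra.
Set Implicit Arguments.
Unset Strict Implicit.
Unset Printing Implicit Defensive.
Import Order.TTheory GRing.Theory Num.Theory.
Import numFieldNormedType.Exports.
Local Open Scope classical_set_scope.
Local Open Scope ring_scope.

(** Write [N_k(s, g)] for the distribution [mu] applied to
    [y |-> \int_0^oo t^(k - n) g((y - a(s)) / t) dt], where [g] ranges over the
    test functions supported in a small ball [F] around [t0 w], [w] in [Lambda].
    Letting the [s]-part of the test functions shrink to a point, the hypothesis
    gives [N_0 = 0].  Differentiating under the integral sign,
    [d/ds N_(k+1)(s, g) = - \sum_j a_j'(s) N_k(s, d_j g)], so if [N_k = 0] then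
    [N_(k+1)] is constant in [s]; it vanishes at a parameter from which the rays
    with direction in [F] miss the support of [mu], hence everywhere.  So all the
    moments in [t] of the continuous function [t^(-n) mu(g((. - a(s)) / t))],
    which is supported in a compact subset of the half-line, are zero; it is
    zero, and at [t = 1] this says that [mu] vanishes near [a(s) + t0 w].

    To avoid differentiating under [mu], the recursion is integrated in [s]
    before [mu] is applied; [mu] commutes with the integral because it is
    bounded, on functions supported in a compact set, by finitely many
    derivatives. *)

(** * Smooth families of functions *)

(** The moments come from scaling: the [s]-derivative of [g((y - a(s)) / t)] carries a factor [1/t],
    so it turns the weight [t^(k + 1 - n)] into [t^(k - n)], and each order determines the next up
    to a constant in [s]. Only one derivative in [s] is available, because [a] is merely
    continuously differentiable; families of functions are therefore smooth in [y] but only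
    continuous in their parameters.

    Two compact sets share the work. The support [K] of a cutoff lies in [U], off the curve, so
    [|y - a(s)|] is bounded below for [y] in [K] and [s] in a compact interval; this confines [t] to
    a segment away from 0. The missing rays are used on the support [D] of [mu] instead: from
    [a(s1)] only the single direction [w] is known to miss [U], and nearby directions may well meet
    [U] or [K], but by compactness they still miss [D].

    The analysis is done for real functionals; a complex distribution enters through its real and
    imaginary parts, after multiplication by the cutoff. *)

Lemma is_derive_littleo {R : realType} {W : normedModType R} (f : W -> R) x v d :
  is_derive x v f d <->
  forall e, 0 < e -> \forall h \near (0 : R), `|f (h *: v + x) - f x - h * d| <= e * `|h|.
Proof.
have quotE h : h != 0 ->
    h^-1 *: (f (h *: v + x) - f x) - d = h^-1 * (f (h *: v + x) - f x - h * d).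
  by move=> h0; rewrite /GRing.scale /= [in RHS]mulrBr mulKf.
split=> [[df dE] e e0|H].
- have : h^-1 *: (f (h *: v + x) - f x) @[h --> 0^'] --> d.
    by rewrite -dE; exact: df.
  move/cvgrPdist_le => /(_ e e0); rewrite near_withinE => df'.
  near=> h; have [->|h0] := eqVneq h 0.
    by rewrite scale0r add0r subrr mul0r subr0 normr0 mulr0.
  have : `|d - h^-1 *: (f (h *: v + x) - f x)| <= e.
    by move: h0; near: h; exact: df'.
  rewrite distrC quotE// normrM normfV mulrC ler_pdivrMr ?normr_gt0//.
have df : h^-1 *: (f (h *: v + x) - f x) @[h --> 0^'] --> d.
  apply/cvgrPdist_le => e e0; rewrite near_withinE; near=> h => h0.
  rewrite distrC quotE// normrM normfV mulrC ler_pdivrMr ?normr_gt0//.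
  by near: h; exact: H.
by split; [apply/cvg_ex; exists d|exact/cvg_lim].
Unshelve. all: by end_near. Qed.

Lemma is_derive_affine {R : realType} {W W' : normedModType R} (g : W' -> R)
    (L : W -> W') (c : R) (b : W') x v d :
  (forall h u w, L (h *: u + w) = h *: L u + L w) ->
  is_derive (c *: (L x - b)) (L v) g d ->
  is_derive x v (fun y => g (c *: (L y - b))) (c * d).
Proof.
move=> linL /is_derive_littleo gd; apply/is_derive_littleo => e e0.
(* Adding 1 covers [c = 0]; the same device recurs in later estimates. *)
have e'0 : 0 < e / (`|c| + 1) by rewrite divr_gt0// ltr_wpDl.
have hc0 : h * c @[h --> (0 : R)] --> 0 * c.
  by apply: cvgM; [exact: cvg_id|exact: cvg_cst].
rewrite mul0r in hc0.
apply: (@filterS _ (nbhs (0 : R)) _ _ _ _ (hc0 _ (gd _ e'0))) => h /=.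
have -> : c *: (L (h *: v + x) - b) = (h * c) *: L v + c *: (L x - b).
  by rewrite linL -addrA [LHS]scalerDr scalerA [c * h]mulrC.
rewrite [h * (c * d)]mulrA => /le_trans.
apply; rewrite normrM [`|h| * _]mulrC mulrA ler_wpM2r// -mulrA.
rewrite ler_piMr ?(ltW e0)//.
by rewrite ler_pdivrMl ?ltr_wpDl// mulr1 lerDl.
Qed.

Lemma continuous_fst_comp {P Q T : topologicalType} (f : P -> T) :
  continuous f -> continuous (fun z : P * Q => f z.1).
Proof. by move=> cf z; apply: (continuous_comp (f := fst)); [exact: cvg_fst|exact: cf]. Qed.

Lemma continuous_snd_comp {P Q T : topologicalType} (f : Q -> T) :
  continuous f -> continuous (fun z : P * Q => f z.2).
Proof. by move=> cf z; apply: (continuous_comp (f := snd)); [exact: cvg_snd|exact: cf]. Qed.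

Section Ck_family.
Context {R : realType}.

(* [k] counts derivatives in [x] only; they are required to be continuous
   jointly in the parameter [p] and [x]. *)
Fixpoint Ck_family (k : nat) {P : topologicalType} {W : normedModType R}
    (Phi : P -> W -> R) : Prop :=
  continuous (fun z : P * W => Phi z.1 z.2) /\
  if k is k'.+1 then
    forall v, exists2 Phi' : P -> W -> R,
      forall p x, is_derive x v (Phi p) (Phi' p x) & Ck_family k' Phi'
  else True.

Definition smooth_family {P : topologicalType} {W : normedModType R}
  (Phi : P -> W -> R) := forall k, Ck_family k Phi.

(* A constant family, over the dummy parameter space [R]. *)
Definition smooth {W : normedModType R} (f : W -> R) :=
  smooth_family (fun _ : R => f).

Context {P Q : topologicalType} {W : normedModType R}.
Implicit Types Phi Psi : P -> W -> R.

Lemma Ck_family_continuous k Phi :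
  Ck_family k Phi -> continuous (fun z : P * W => Phi z.1 z.2).
Proof. by case: k => [|k] []. Qed.

Lemma Ck_familyS k Phi : Ck_family k.+1 Phi -> Ck_family k Phi.
Proof.
elim: k Phi => [|k IH] Phi [cPhi dPhi]; split=> // v.
by have [Phi' ? ?] := dPhi v; exists Phi' => //; exact: IH.
Qed.

Lemma Ck_family_reparam k Phi (theta : Q -> P) :
  continuous theta -> Ck_family k Phi -> Ck_family k (Phi \o theta).
Proof.
move=> ctheta.
have ccomp (F : P -> W -> R) : continuous (fun z : P * W => F z.1 z.2) ->
    continuous (fun z : Q * W => F (theta z.1) z.2).
  move=> cF z; apply: (@continuous_comp _ _ _
    (fun z : Q * W => (theta z.1, z.2)) (fun z : P * W => F z.1 z.2)); last exact: cF.
  apply: cvg_pair; last exact: cvg_snd.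
  by apply: continuous_cvg; [exact: ctheta|exact: cvg_fst].
elim: k Phi => [|k IH] Phi [/ccomp cPhi dPhi]; split=> // v.
by have [Phi' d' C'] := dPhi v; exists (Phi' \o theta); [move=> p x; exact: d'|exact: IH].
Qed.

Lemma Ck_familyD k Phi Psi : Ck_family k Phi -> Ck_family k Psi ->
  Ck_family k (fun p x => Phi p x + Psi p x).
Proof.
elim: k Phi Psi => [|k IH] Phi Psi [cPhi dPhi] [cPsi dPsi]; split=> //.
- by move=> z; apply: cvgD; [exact: cPhi|exact: cPsi].
- by move=> z; apply: cvgD; [exact: cPhi|exact: cPsi].
move=> v; have [Phi' d1 C1] := dPhi v; have [Psi' d2 C2] := dPsi v.
exists (fun p x => Phi' p x + Psi' p x); last exact: IH.
by move=> p x; exact: is_deriveD.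
Qed.

Lemma Ck_familyM k Phi Psi : Ck_family k Phi -> Ck_family k Psi ->
  Ck_family k (fun p x => Phi p x * Psi p x).
Proof.
elim: k Phi Psi => [|k IH] Phi Psi HPhi HPsi; move: (HPhi) (HPsi) => [cPhi dPhi] [cPsi dPsi].
  by split=> // z; apply: cvgM; [exact: cPhi|exact: cPsi].
split=> [|v]; first by move=> z; apply: cvgM; [exact: cPhi|exact: cPsi].
have [Phi' d1 C1] := dPhi v; have [Psi' d2 C2] := dPsi v.
exists (fun p x => Phi p x * Psi' p x + Psi p x * Phi' p x).
  by move=> p x; exact: is_deriveM.
by apply: Ck_familyD; apply: IH => //; exact: Ck_familyS.
Qed.

Lemma Ck_family_cst k (kappa : P -> R) :
  continuous kappa -> Ck_family k (fun p (_ : W) => kappa p).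
Proof.
elim: k kappa => [|k IH] kappa ck; split=> //.
- exact: continuous_fst_comp.
- exact: continuous_fst_comp.
move=> v; exists (fun _ _ => 0); last by apply: IH => z; exact: cvg_cst.
by move=> p x; exact: is_derive_cst.
Qed.

Lemma Ck_family_sum k (T : Type) (r : seq T) (Phi : T -> P -> W -> R) :
  (forall i, Ck_family k (Phi i)) ->
  Ck_family k (fun p x => \sum_(i <- r) Phi i p x).
Proof.
move=> CPhi; elim: r => [|i r IH].
  under eq_fun do under eq_fun do rewrite big_nil.
  by apply: Ck_family_cst => z; exact: cvg_cst.
under eq_fun do under eq_fun do rewrite big_cons.
exact: Ck_familyD.
Qed.

End Ck_family.

(** The weight [kappa] closes the induction: each derivative brings out a factor [c p], which it
    absorbs. [L] will be the identity, a coordinate or a projection of a product. *)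
Lemma Ck_family_affine {R : realType} {P : topologicalType} {W W' : normedModType R} k (g : W' -> R) (L : W -> W')
    (kappa c : P -> R) (b : P -> W') :
  continuous L -> (forall h u w, L (h *: u + w) = h *: L u + L w) ->
  continuous kappa -> continuous c -> continuous b ->
  Ck_family k (fun _ : R => g) ->
  Ck_family k (fun p x => kappa p * g (c p *: (L x - b p))).
Proof.
move=> cL linL + cc cb.
have cont (g' : W' -> R) (ka : P -> R) : continuous ka -> continuous (fun z : R * W' => g' z.2) ->
    continuous (fun z : P * W => ka z.1 * g' (c z.1 *: (L z.2 - b z.1))).
  move=> cka cg z.
  apply: cvgM; first exact: (continuous_fst_comp cka).
  apply: (@continuous_comp _ _ _
    (fun z : P * W => (0 : R, c z.1 *: (L z.2 - b z.1))) (fun z : R * W' => g' z.2)); last exact: cg.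
  apply: (@cvg_pair _ _ _ (nbhs z) (nbhs (0 : R)) (nbhs (c z.1 *: (L z.2 - b z.1)))).
    exact: cvg_cst.
  apply: cvgZ; first exact: (continuous_fst_comp cc).
  by apply: cvgB; [exact: (continuous_snd_comp cL)|exact: (continuous_fst_comp cb)].
elim: k g kappa => [|k IH] g kappa ck [cg dg]; split=> //; [exact: cont..|].
move=> v; have [g' d' C'] := dg (L v).
exists (fun p x => kappa p * c p * g' 0 (c p *: (L x - b p))).
  move=> p x; rewrite -mulrA; apply: is_deriveZ.
  by apply: is_derive_affine => //; exact: d'.
apply: IH; first by move=> z; apply: cvgM; [exact: ck|exact: cc].
exact: (Ck_family_reparam (theta := fun=> 0) (@cst_continuous _ _ _) C').
Qed.

Lemma Ck_familyV {R : realType} {P : topologicalType} {W : normedModType R} k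
    (Phi : P -> W -> R) :
  (forall p x, Phi p x != 0) -> Ck_family k Phi ->
  Ck_family k (fun p x => (Phi p x)^-1).
Proof.
move=> Phi0; elim: k => [|k IH] CPhi; (split=> //;
  first by move=> z; apply: cvgV => //; exact: Ck_family_continuous CPhi z).
move=> v; have [_ /(_ v)[Phi' d' C']] := CPhi.
exists (fun p x => - 1 * Phi' p x * (Phi p x)^-1 * (Phi p x)^-1).
  move=> p x; have dPhi := d' p x; split; first exact: derivableV.
  rewrite deriveV// derive_val expr2 invfM /GRing.scale /=.
  by rewrite mulN1r !mulNr mulrC mulrA.
have CV := IH (Ck_familyS CPhi).
apply: Ck_familyM => //; apply: Ck_familyM => //; apply: Ck_familyM => //.
by apply: Ck_family_cst; exact: cst_continuous.
Qed.

Section smooth_functions.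
Context {R : realType} {W : normedModType R}.
Implicit Types f g : W -> R.

Lemma smooth_family_derive {P : topologicalType} (Phi : P -> W -> R) v :
  smooth_family Phi -> smooth_family (fun p x => 'D_v (Phi p) x).
Proof.
move=> sPhi k; have [_ /(_ v)[Phi' d' C']] := sPhi k.+1.
suff -> : (fun p x => 'D_v (Phi p) x) = Phi' by [].
by apply/funext => p; apply/funext => x; have dPhi := d' p x; rewrite derive_val.
Qed.

Lemma smooth_family_is_derive {P : topologicalType} (Phi : P -> W -> R) p x v :
  smooth_family Phi -> is_derive x v (Phi p) ('D_v (Phi p) x).
Proof.
move=> sPhi; have [_ /(_ v)[Phi' d' C']] := sPhi 1%N.
by have dPhi := d' p x; apply: derivableP.
Qed.

Lemma smooth_family_const {P : topologicalType} f :
  smooth f -> smooth_family (fun _ : P => f).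
Proof.
by move=> sf k; exact: (Ck_family_reparam (theta := fun=> 0) (@cst_continuous _ _ _) (sf k)).
Qed.

Lemma smooth_family_smooth {P : topologicalType} (Phi : P -> W -> R) p :
  smooth_family Phi -> smooth (Phi p).
Proof.
by move=> sf k; exact: (Ck_family_reparam (theta := fun=> p) (@cst_continuous _ _ _) (sf k)).
Qed.

Lemma smooth_is_derive f x v : smooth f -> is_derive x v f ('D_v f x).
Proof. by move/(@smooth_family_is_derive _ _ 0); exact. Qed.

Lemma smooth_derive f v : smooth f -> smooth (fun x => 'D_v f x).
Proof. exact: smooth_family_derive. Qed.

Lemma smooth_continuous f : smooth f -> continuous f.
Proof.
move=> /(_ 0%N)[cf _] x; have /(_ (0, x)) := cf.
apply: (@continuous_comp _ _ _ (fun x : W => (0 : R, x)) (fun z : R * W => f z.2)).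
by apply: (@cvg_pair _ _ _ (nbhs x) (nbhs (0 : R)) (nbhs x)); [exact: cvg_cst|exact: cvg_id].
Qed.

Lemma smoothD f g : smooth f -> smooth g -> smooth (fun x => f x + g x).
Proof. by move=> sf sg k; exact: Ck_familyD. Qed.

Lemma smoothM f g : smooth f -> smooth g -> smooth (fun x => f x * g x).
Proof. by move=> sf sg k; exact: Ck_familyM. Qed.

Lemma smooth_cst c : smooth (fun _ : W => c).
Proof. by move=> k; apply: Ck_family_cst; exact: cst_continuous. Qed.

Lemma smoothN f : smooth f -> smooth (fun x => - f x).
Proof.
move=> sf; under eq_fun do rewrite -mulN1r.
exact/smoothM/sf/smooth_cst.
Qed.

Lemma smoothB f g : smooth f -> smooth g -> smooth (fun x => f x - g x).
Proof. by move=> sf sg; apply: smoothD => //; exact: smoothN. Qed.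

Lemma smooth_sum (T : Type) (r : seq T) (f : T -> W -> R) :
  (forall i, smooth (f i)) -> smooth (fun x => \sum_(i <- r) f i x).
Proof. by move=> sf k; apply: Ck_family_sum => i; exact: sf. Qed.

Lemma smooth_prod (T : Type) (r : seq T) (f : T -> W -> R) :
  (forall i, smooth (f i)) -> smooth (fun x => \prod_(i <- r) f i x).
Proof.
move=> sf; elim: r => [|i r IH].
  by under eq_fun do rewrite big_nil; exact: smooth_cst.
by under eq_fun do rewrite big_cons; exact: smoothM.
Qed.

Lemma smooth_realP f : smooth_real setT f <-> smooth f.
Proof.
split=> [sf k|sf vs x _].
  elim: k f sf => [|k IH] f sf; (split=> //;
    first by apply: continuous_snd_comp => x; exact: (sf [::] x I).1).
  move=> v; exists (fun _ x => 'D_v f x).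
    by move=> _ x; apply: derivableP; exact: (sf [::] x I).2.
  apply: IH => vs x _; have := sf (rcons vs v) x I.
  by rewrite /iter_deriv foldr_rcons.
have {}sf : smooth (iter_deriv vs f).
  by elim: vs => //= v vs IH; exact: smooth_derive.
by split=> [|v]; [exact: smooth_continuous|have [] := smooth_is_derive x v sf].
Qed.

End smooth_functions.

Lemma smooth_affine {R : realType} {W W' : normedModType R} (g : W' -> R)
    (L : W -> W') (c : R) (b : W') :
  continuous L -> (forall h u w, L (h *: u + w) = h *: L u + L w) ->
  smooth g -> smooth (fun x => g (c *: (L x - b))).
Proof.
move=> cL linL sg k; under eq_fun do under eq_fun do rewrite -[g _]mul1r.
exact: (@Ck_family_affine _ R _ _ k g L (fun=> 1) (fun=> c) (fun=> b)
  cL linL (@cst_continuous _ _ _) (@cst_continuous _ _ _) (@cst_continuous _ _ _)).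
Qed.

(** * Integrals over segments *)

(** Tube argument: around each [t] a product neighbourhood keeps both [F p t'] and [F p0 t'] within
    [e / 2] of [F p0 t], and compactness of [K] leaves a single neighbourhood of [p0]. *)
Lemma compact_near_uniform {R : realType} {P T : topologicalType} (K : set T)
    (F : P -> T -> R) p0 e :
  compact K -> 0 < e ->
  (forall t, K t -> {for (p0, t), continuous (fun z : P * T => F z.1 z.2)}) ->
  \forall p \near p0, forall t, K t -> `|F p t - F p0 t| < e.
Proof.
move=> /compact_near_coveringP cK e0 cF.
apply: (cK P (nbhs p0) (fun p t => `|F p t - F p0 t| < e)) => t Kt.
have e20 : 0 < e / 2 by rewrite divr_gt0.
have /cvgrPdist_lt/(_ _ e20) := cF t Kt.
move=> [[A B] /= [Ap0 Bt] AB].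
exists (B, A) => //= -[t' p] /= [Bt' Ap].
have := AB (p, t') (conj Ap Bt'); have := AB (p0, t') (conj (nbhs_singleton Ap0) Bt').
rewrite /= => h1 h2.
rewrite (_ : F p t' - F p0 t' = (F p0 t - F p0 t') - (F p0 t - F p t')); last by ring.
by rewrite (splitr e); apply: le_lt_trans (ler_normB _ _) _; apply: ltrD.
Qed.

Section segment_integral.
Context {R : realType}.
Implicit Types (f g : R -> R) (a b c : R).

Definition sint a b f : R := \int[lebesgue_measure]_(x in `[a, b]) f x.

Lemma continuous_integrable a b f : continuous f ->
  lebesgue_measure.-integrable `[a, b] (EFin \o f).
Proof.
move=> cf; apply: continuous_compact_integrable; first exact: segment_compact.
exact: continuous_subspaceT.
Qed.

Lemma eq_sint a b f g : (forall x, a <= x <= b -> f x = g x) -> sint a b f = sint a b g.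
Proof.
by move=> fg; apply: eq_Rintegral => x /set_mem/=; rewrite in_itv/=; exact: fg.
Qed.

Lemma sintZ a b c f : continuous f -> sint a b (fun x => c * f x) = c * sint a b f.
Proof. by move=> cf; apply: RintegralZl => //; exact: continuous_integrable. Qed.

Lemma sintD a b f g : continuous f -> continuous g ->
  sint a b (fun x => f x + g x) = sint a b f + sint a b g.
Proof. by move=> cf cg; apply: RintegralD => //; exact: continuous_integrable. Qed.

Lemma sintB a b f g : continuous f -> continuous g ->
  sint a b (fun x => f x - g x) = sint a b f - sint a b g.
Proof. by move=> cf cg; apply: RintegralB => //; exact: continuous_integrable. Qed.

Lemma sint_cst a b c : a <= b -> sint a b (fun=> c) = c * (b - a).
Proof.
move=> ab; rewrite /sint Rintegral_cst//= lebesgue_measure_itv/= lte_fin.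
by case: ltgtP ab => //= -> _; rewrite subrr.
Qed.

Lemma sint0 a b : sint a b (fun=> 0) = 0.
Proof. by rewrite /sint Rintegral_cst ?mul0r. Qed.

Lemma sint_le a b f g : continuous f -> continuous g ->
  (forall x, a <= x <= b -> f x <= g x) -> sint a b f <= sint a b g.
Proof.
move=> cf cg fg.
apply: (le_Rintegral _ (continuous_integrable a b cf) (continuous_integrable a b cg)).
  by [].
by move=> x /=; rewrite in_itv/=; exact: fg.
Qed.

Lemma sint_norm_le a b f M : a <= b -> continuous f ->
  (forall x, a <= x <= b -> `|f x| <= M) -> `|sint a b f| <= M * (b - a).
Proof.
move=> ab cf fM; rewrite -sint_cst// ler_norml; apply/andP; split.
  have -> : - sint a b (fun=> M) = sint a b (fun=> - M).
    by rewrite !sint_cst// mulNr.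
  apply: sint_le => //; first exact: cst_continuous.
  by move=> x /fM; rewrite ler_norml => /andP[].
apply: sint_le => //; first exact: cst_continuous.
by move=> x /fM; rewrite ler_norml => /andP[].
Qed.

Lemma sint_split a b c f : continuous f -> a <= b -> b <= c ->
  sint a c f = sint a b f + sint b c f.
Proof.
move=> cf ab bc; apply/eqP; rewrite addrC -subr_eq; apply/eqP.
rewrite /sint Rintegral_itvB//; last exact: continuous_integrable.
rewrite Rintegral_itv_obnd_cbnd//.
apply: integrableS (continuous_integrable b c cf) => //.
exact: subset_itv_oc_cc.
Qed.

Lemma sint_param_continuous {P : topologicalType} a b (F : P -> R -> R) : a <= b ->
  continuous (fun z : P * R => F z.1 z.2) -> continuous (fun p => sint a b (F p)).
Proof.
move=> ab cF p0; apply/cvgrPdist_le => e e0.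
have cFp p : continuous (F p).
  move=> t; apply: (@continuous_comp _ _ _ (fun t => (p, t)) (fun z : P * R => F z.1 z.2)); last exact: cF.
  by apply: (@cvg_pair _ _ _ (nbhs t) (nbhs p) (nbhs t)); [exact: cvg_cst|exact: cvg_id].
have e'0 : 0 < e / (b - a + 1) by rewrite divr_gt0// ltr_wpDl// subr_ge0.
have := @compact_near_uniform _ _ _ _ F p0 _ (@segment_compact R a b) e'0 (fun t _ => cF (p0, t)).
apply: filterS => p /= Fp.
rewrite distrC -sintB//.
apply: (@le_trans _ _ (e / (b - a + 1) * (b - a))).
  apply: sint_norm_le => //; first by move=> x; apply: cvgB; exact: cFp.
  by move=> x xab; apply/ltW/Fp; rewrite /= in_itv.
rewrite -mulrA ler_piMr ?(ltW e0)// ler_pdivrMl ?ltr_wpDl ?subr_ge0//.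
by rewrite mulr1 lerDl.
Qed.

(* A form of the mean value theorem in which the increment may have any sign. *)
Lemma MVT_sym f f' (x0 h : R) :
  (forall x : R, `|x - x0| <= `|h| -> is_derive (x : R) (1 : R) f (f' x)) ->
  exists2 c, `|c - x0| <= `|h| & f (h + x0) - f x0 = h * f' c.
Proof.
move=> df.
have cf A : (forall x, A x -> `|x - x0| <= `|h|) -> {within A, continuous f}.
  move=> Ah; apply: continuous_in_subspaceT => x /set_mem /Ah xh.
  by apply: differentiable_continuous; apply/derivable1_diffP; have [] := df x xh.
have [hgt0|hlt0|h0] := ltgtP 0 h.
- have [|||c] := @MVT R f f' x0 (h + x0).
  + by rewrite ltrDr.
  + by move=> x; rewrite in_itv/= => /andP[? ?]; apply: df; rewrite (gtr0_norm hgt0) ler_norml; lra.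
  + by apply: cf => x /=; rewrite in_itv/= (gtr0_norm hgt0) ler_norml; lra.
  rewrite in_itv/= => /andP[? ?] ->; exists c; last by ring.
  by rewrite (gtr0_norm hgt0) ler_norml; lra.
- have [|||c] := @MVT R f f' (h + x0) x0.
  + by rewrite gtrDr.
  + by move=> x; rewrite in_itv/= => /andP[? ?]; apply: df; rewrite (ltr0_norm hlt0) ler_norml; lra.
  + by apply: cf => x /=; rewrite in_itv/= (ltr0_norm hlt0) ler_norml; lra.
  rewrite in_itv/= => /andP[? ?] E; exists c; last by rewrite -[LHS]opprB E; ring.
  by rewrite (ltr0_norm hlt0) ler_norml; lra.
- by exists x0; rewrite -h0 ?subrr ?normr0// add0r subrr mul0r.
Qed.

(* Domination is automatic: the mean value theorem bounds the remainder by the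
   modulus of continuity of [f'], which is uniform over the compact [[a, b]]. *)
Lemma sint_is_derive a b (f f' : R -> R -> R) (x0 : R) : a <= b ->
  (\forall x \near x0, forall t : R, is_derive (x : R) (1 : R) (fun y : R => f y t) (f' x t)) ->
  (forall x, continuous (f x)) -> continuous (f' x0) ->
  (forall t, {for (x0, t), continuous (fun z : R * R => f' z.1 z.2)}) ->
  is_derive x0 (1 : R) (fun x : R => sint a b (f x)) (sint a b (f' x0)).
Proof.
move=> ab df cf cf'x0 cf'; apply/is_derive_littleo => e e0.
have e'0 : 0 < e / (b - a + 1) by rewrite divr_gt0// ltr_wpDl// subr_ge0.
have := @compact_near_uniform _ _ _ _ f' x0 _ (@segment_compact R a b) e'0 (fun t _ => cf' t).
move: df => /nbhs_ballP[d1 /= d10 df] /nbhs_ballP[d2 /= d20 f'e].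
near=> h.
have hd1 : `|h| < d1 by near: h; exact: (@nbhs0_lt _ R).
have hd2 : `|h| < d2 by near: h; exact: (@nbhs0_lt _ R).
rewrite /GRing.scale/= mulr1 -sintZ// -!sintB//; last 2 first.
- by move=> x; apply: cvgB; exact: cf.
- by move=> x; apply: cvgM; [exact: cvg_cst|exact: cf'x0].
apply: (@le_trans _ _ (e / (b - a + 1) * `|h| * (b - a))); last first.
  rewrite -mulrA [`|h| * _]mulrC mulrA ler_wpM2r// -mulrA ler_piMr ?(ltW e0)//.
  by rewrite ler_pdivrMl ?ltr_wpDl ?subr_ge0// mulr1 lerDl.
apply: sint_norm_le => //.
  move=> x; apply: cvgB; last by apply: cvgM; [exact: cvg_cst|exact: cf'x0].
  by apply: cvgB; exact: cf.
move=> t tab.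
have [c cx ->] := @MVT_sym (fun y => f y t) (f'^~ t) x0 h (fun x xh =>
  df x (ltac:(by rewrite /ball/= distrC; exact: le_lt_trans hd1)) t).
rewrite -mulrBr normrM mulrC ler_wpM2r//; apply/ltW/f'e; last by rewrite /= in_itv.
by rewrite /ball/= distrC; exact: le_lt_trans hd2.
Unshelve. all: by end_near. Qed.

End segment_integral.

Lemma is_derive_line {R : realType} {W : normedModType R} (f : W -> R) x v (h0 : R) d :
  is_derive (h0 *: v + x) v f d -> is_derive h0 (1 : R) (fun h : R => f (h *: v + x)) d.
Proof.
move=> /is_derive_littleo df; apply/is_derive_littleo => e /df; apply: filterS => h.
by rewrite addrA -scalerDl /GRing.scale/= mulr1.
Qed.

Lemma is_derive_line0 {R : realType} {W : normedModType R} (f : W -> R) x v d :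
  is_derive (0 : R) (1 : R) (fun h : R => f (h *: v + x)) d -> is_derive x v f d.
Proof.
move=> /is_derive_littleo df; apply/is_derive_littleo => e /df; apply: filterS => h.
have -> : h *: (1 : R) + 0 = h by rewrite /GRing.scale/= mulr1 addr0.
by rewrite scale0r add0r.
Qed.

Lemma continuous_slice {P Q T : topologicalType} (F : P -> Q -> T) p :
  continuous (fun z : P * Q => F z.1 z.2) -> continuous (F p).
Proof.
move=> cF t; apply: (@continuous_comp _ _ _ (fun t => (p, t)) (fun z : P * Q => F z.1 z.2)); last exact: cF.
by apply: (@cvg_pair _ _ _ (nbhs t) (nbhs p) (nbhs t)); [exact: cvg_cst|exact: cvg_id].
Qed.

Lemma continuous_slice2 {P Q T : topologicalType} (F : P -> Q -> T) q :
  continuous (fun z : P * Q => F z.1 z.2) -> continuous (F ^~ q).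
Proof.
move=> cF t; apply: (@continuous_comp _ _ _ (fun t => (t, q)) (fun z : P * Q => F z.1 z.2)); last exact: cF.
by apply: (@cvg_pair _ _ _ (nbhs t) (nbhs t) (nbhs q)); [exact: cvg_id|exact: cvg_cst].
Qed.

Lemma is_derive_sint_family {R : realType} {W : normedModType R} (a b : R)
    (Phi Phi' : R -> W -> R) x v : a <= b ->
  continuous (fun z : R * W => Phi z.1 z.2) ->
  continuous (fun z : R * W => Phi' z.1 z.2) ->
  (forall t y, is_derive y v (Phi t) (Phi' t y)) ->
  is_derive x v (fun y => sint a b (fun t => Phi t y)) (sint a b (fun t => Phi' t x)).
Proof.
move=> ab cPhi cPhi' d'; apply: is_derive_line0.
have line (Psi : R -> W -> R) : continuous (fun z : R * W => Psi z.1 z.2) ->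
    continuous (fun z : R * R => Psi z.2 (z.1 *: v + x)).
  move=> cPsi z; apply: (@continuous_comp _ _ _ (fun z : R * R => (z.2, z.1 *: v + x))
    (fun z : R * W => Psi z.1 z.2)); last exact: cPsi.
  apply: (@cvg_pair _ _ _ (nbhs z) (nbhs z.2) (nbhs (z.1 *: v + x))); first exact: cvg_snd.
  by apply: cvgD; [apply: cvgZr_tmp; exact: cvg_fst|exact: cvg_cst].
have <- : sint a b (fun t => Phi' t (0 *: v + x)) = sint a b (fun t => Phi' t x).
  by congr sint; apply/funext => t; rewrite scale0r add0r.
apply: (@sint_is_derive _ a b (fun h t => Phi t (h *: v + x))
  (fun h t => Phi' t (h *: v + x))) => //.
- by near=> h => t; apply: is_derive_line.
- by move=> h; exact: (@continuous_slice R R R (fun h t => Phi t (h *: v + x)) h (line _ cPhi)).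
- exact: (@continuous_slice R R R (fun h t => Phi' t (h *: v + x)) 0 (line _ cPhi')).
- by move=> t; exact: line.
Unshelve. all: by end_near. Qed.

Lemma Ck_family_sint {R : realType} {P : topologicalType} {W : normedModType R} k
    (a b : R) (Phi : P * R -> W -> R) : a <= b -> Ck_family k Phi ->
  Ck_family k (fun p x => sint a b (fun t => Phi (p, t) x)).
Proof.
move=> ab.
have swap (Psi : P * R -> W -> R) : continuous (fun z : (P * R) * W => Psi z.1 z.2) ->
    continuous (fun z : (P * W) * R => Psi (z.1.1, z.2) z.1.2).
  move=> cPsi z; apply: (@continuous_comp _ _ _ (fun z : (P * W) * R => ((z.1.1, z.2), z.1.2))
    (fun z : (P * R) * W => Psi z.1 z.2)); last exact: cPsi.
  apply: (@cvg_pair _ _ _ (nbhs z) (nbhs (z.1.1, z.2)) (nbhs z.1.2)).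
    apply: (@cvg_pair _ _ _ (nbhs z) (nbhs z.1.1) (nbhs z.2)); last exact: cvg_snd.
    exact: (continuous_fst_comp (Q := R) (fun w : P * W => @cvg_fst _ _ (nbhs w.1) (nbhs w.2) _)).
  exact: (continuous_fst_comp (Q := R) (fun w : P * W => @cvg_snd _ _ (nbhs w.1) (nbhs w.2) _)).
have contP (Psi : P * R -> W -> R) : continuous (fun z : (P * R) * W => Psi z.1 z.2) ->
    continuous (fun z : P * W => sint a b (fun t => Psi (z.1, t) z.2)).
  by move=> /swap; exact: sint_param_continuous.
elim: k Phi => [|k IH] Phi [cPhi dPhi]; split=> //; [exact: contP..|].
move=> v; have [Phi' d' C'] := dPhi v.
exists (fun p x => sint a b (fun t => Phi' (p, t) x)); last exact: IH.
have fix_p (Psi : P * R -> W -> R) p : continuous (fun z : (P * R) * W => Psi z.1 z.2) ->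
    continuous (fun z : R * W => Psi (p, z.1) z.2).
  move=> cPsi z; apply: (@continuous_comp _ _ _ (fun z : R * W => ((p, z.1), z.2))
    (fun z : (P * R) * W => Psi z.1 z.2)); last exact: cPsi.
  apply: (@cvg_pair _ _ _ (nbhs z) (nbhs (p, z.1)) (nbhs z.2)); last exact: cvg_snd.
  by apply: (@cvg_pair _ _ _ (nbhs z) (nbhs p) (nbhs z.1)); [exact: cvg_cst|exact: cvg_fst].
move=> p x.
apply: (is_derive_sint_family (Phi := fun t => Phi (p, t)) (Phi' := fun t => Phi' (p, t))) => //.
- exact: (fix_p Phi).
- exact/(fix_p Phi')/(Ck_family_continuous C').
Qed.

Lemma smooth_family_sint {R : realType} {P : topologicalType} {W : normedModType R}
    (a b : R) (Phi : P * R -> W -> R) : a <= b -> smooth_family Phi ->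
  smooth_family (fun p x => sint a b (fun t => Phi (p, t) x)).
Proof. by move=> ab sPhi k; exact: Ck_family_sint. Qed.

Lemma smooth_sint {R : realType} {W : normedModType R} (a b : R) (Phi : R -> W -> R) :
  a <= b -> smooth_family Phi -> smooth (fun x => sint a b (fun t => Phi t x)).
Proof.
move=> ab sPhi.
apply: (smooth_family_smooth (P := R) (Phi := fun (_ : R) x => sint a b (fun t => Phi t x)) 0).
apply: (smooth_family_sint (Phi := fun z : R * R => Phi z.2) ab) => k.
by apply: (Ck_family_reparam (theta := snd)) => // z; exact: cvg_snd.
Qed.

(** * The chain rule along curves *)

Section row_vectors.
Context {R : realType} {n : nat}.
Implicit Types x : 'rV[R]_n.

Lemma rV_norm_ge x j : `|x 0 j| <= `|x|.
Proof.
rewrite [leRHS]/Num.Def.normr/= mx_normrE.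
exact: (@le_bigmax _ _ _ 0 (fun i : 'I_1 * 'I_n => `|x i.1 i.2|) (0, j)).
Qed.

Lemma rV_norm_lt x r : 0 < r -> (forall j, `|x 0 j| < r) -> `|x| < r.
Proof.
move=> r0 xr; rewrite [ltLHS]/Num.Def.normr/= mx_normrE.
by apply: bigmax_lt => // -[i j] _ /=; rewrite ord1.
Qed.

Lemma rV_norm_le x r : 0 <= r -> (forall j, `|x 0 j| <= r) -> `|x| <= r.
Proof.
move=> r0 xr; rewrite [leLHS]/Num.Def.normr/= mx_normrE.
by apply: bigmax_le => // -[i j] _ /=; rewrite ord1.
Qed.

Lemma norm_basis_dir (j : 'I_n) : `|basis_dir j : 'rV[R]_n| <= 1.
Proof.
apply: rV_norm_le => // k; rewrite /basis_dir mxE eqxx/=.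
by case: (k == j); rewrite ?normr1 ?normr0.
Qed.

(** Continuous partial derivatives give total differentiability: the coordinates of [d] are moved
    one at a time, and the mean value theorem turns each increment into a partial derivative at a
    point near [x]. Each of the [n] moves costs at most [e / (n + 1) * |d|]. *)
Lemma smooth_littleo (g : 'rV[R]_n -> R) x e : smooth g -> 0 < e ->
  \forall d \near (0 : 'rV[R]_n),
    `|g (d + x) - g x - \sum_(j < n) d 0 j * 'D_(basis_dir j) g x| <= e * `|d|.
Proof.
move=> sg e0.
have e'0 : 0 < e / (n%:R + 1) by rewrite divr_gt0// ltr_wpDl.
have cDg : \forall y \near x, forall j : 'I_n,
    `|'D_(basis_dir j) g x - 'D_(basis_dir j) g y| < e / (n%:R + 1).
  apply: (@filter_forall _ 'I_n _ (nbhs x)) => j.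
  have /cvgrPdist_lt := @smooth_continuous _ _ _ (smooth_derive (basis_dir j) sg) x.
  exact.
case/nbhs_ballP : cDg => r /= r0 cDg.
have r'0 : 0 < r / (n%:R + 1) by rewrite divr_gt0// ltr_wpDl.
near=> d.
have dr : `|d| < r / (n%:R + 1).
  by near: d; exact: (@nbhs0_lt _ 'rV[R]_n).
(* The displacement once the coordinates listed in [s] have been moved; over the full enumeration it
   is [d]. *)
pose S (s : seq 'I_n) : 'rV[R]_n := \sum_(j <- s) d 0 j *: basis_dir j.
have normS s : `|S s| <= (size s)%:R * `|d|.
  rewrite /S; elim: s => [|j s IH]; first by rewrite big_nil normr0 mul0r.
  rewrite big_cons; apply: (le_trans (ler_normD _ _)).
  rewrite -natr1 mulrDl mul1r addrC lerD// normrZ.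
  rewrite -[leRHS]mulr1; apply: ler_pM => //; first exact: rV_norm_ge.
  exact: norm_basis_dir.
have key s : (size s <= n)%N ->
    `|g (S s + x) - g x - \sum_(j <- s) d 0 j * 'D_(basis_dir j) g x|
    <= (size s)%:R * (e / (n%:R + 1) * `|d|).
  elim: s => [|j s IH] sn.
    by rewrite /S !big_nil add0r subrr subr0 normr0 mul0r.
  have [|c cd] := @MVT_sym R (fun h => g (h *: basis_dir j + (S s + x)))
      (fun h => 'D_(basis_dir j) g (h *: basis_dir j + (S s + x))) 0 (d 0 j).
    by move=> h _; apply: is_derive_line; exact: smooth_is_derive.
  rewrite addr0 scale0r add0r subr0 in cd * => gE.
  have SE : S (j :: s) + x = d 0 j *: basis_dir j + (S s + x).
    by rewrite /S big_cons addrA.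
  rewrite SE big_cons.
  set u := c *: basis_dir j + (S s + x) in gE.
  rewrite (_ : _ - _ - _ = (g (S s + x) - g x - \sum_(j0 <- s) d 0 j0 * 'D_(basis_dir j0) g x)
     + d 0 j * ('D_(basis_dir j) g u - 'D_(basis_dir j) g x)); last first.
    by rewrite mulrBr -gE; ring.
  apply: (le_trans (ler_normD _ _)); rewrite /= -[in leRHS]natr1 mulrDl mul1r.
  apply: lerD; first exact/IH/ltnW.
  rewrite normrM mulrC; apply: ler_pM => //; last exact: rV_norm_ge.
  rewrite distrC; apply/ltW/cDg; rewrite -ball_normE/= distrC /u addrA addrK.
  apply: (@le_lt_trans _ _ (n%:R * `|d|)).
    apply: (le_trans (ler_normD _ _)); rewrite normrZ.
    apply: (@le_trans _ _ (`|d| * 1 + (size s)%:R * `|d|)).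
      apply: lerD => //; apply: ler_pM => //; last exact: norm_basis_dir.
      by apply: le_trans cd _; exact: rV_norm_ge.
    by rewrite mulr1 -{1}[`|d|]mul1r -mulrDl ler_wpM2r// addrC natr1 ler_nat.
  apply: (@le_lt_trans _ _ ((n%:R + 1) * `|d|)); first by rewrite ler_wpM2r// lerDl.
  by rewrite mulrC -ltr_pdivlMr// ltr_wpDl.
have := key (index_enum 'I_n).
have -> : S (index_enum 'I_n) = d by rewrite /S -row_sum_delta.
have -> : size (index_enum 'I_n) = n by rewrite -[RHS]card_ord cardT enumT.
move/(_ (leqnn n)) => /le_trans; apply.
rewrite mulrA ler_wpM2r// mulrCA ler_piMr ?(ltW e0)//.
by rewrite ler_pdivrMr ?mul1r ?lerDl// ltr_wpDl.
Unshelve. all: by end_near. Qed.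

Lemma is_derive_curve (g : 'rV[R]_n -> R) (gam : R -> 'rV[R]_n) (s : R) :
  smooth g -> derivable gam s 1 ->
  is_derive s (1 : R) (fun t => g (gam t))
    (\sum_(j < n) ('D_1 gam s) 0 j * 'D_(basis_dir j) g (gam s)).
Proof.
move=> sg dgam; apply/is_derive_littleo => e e0.
set dg := 'D_1 gam s; set X := \sum_(j < n) `|'D_(basis_dir j) g (gam s)|.
have X0 : 0 <= X by apply: sumr_ge0.
(* [e1] pays for the remainder of [g] and [e2] for that of [gam]; capping [e2] by 1 yields the bound
   [(|dg| + 1) * |h|] on the increment of [gam]. *)
pose e1 := e / 2 / (`|dg| + 1).
pose e2 := Order.min 1 (e / 2 / (X + 1)).
have e20' : 0 < e / 2 by rewrite divr_gt0.
have e10 : 0 < e1 by rewrite divr_gt0// ltr_wpDl.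
have e20 : 0 < e2 by rewrite lt_min ltr01/= divr_gt0// ltr_wpDl.
have dgamj : \forall h \near (0 : R), forall j : 'I_n,
    `|(gam (h *: 1 + s) - gam s) 0 j - h * dg 0 j| <= e2 * `|h|.
  apply: (@filter_forall _ 'I_n _ (nbhs (0 : R))) => j.
  have dj : is_derive s (1 : R) (fun t => gam t 0 j) (dg 0 j).
    have /derivable_mxP/(_ 0 j) dj := dgam.
    by apply: DeriveDef => //; rewrite /dg (derive_mx dgam) mxE.
  by move/is_derive_littleo : dj => /(_ _ e20); apply: filterS => h; rewrite !mxE.
have cgam : gam (h *: 1 + s) - gam s @[h --> (0 : R)] --> (0 : 'rV[R]_n).
  have /derivable1_diffP/differentiable_continuous cg := dgam.
  have c1 : h *: (1 : R) + s @[h --> (0 : R)] --> 0 *: (1 : R) + s.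
    by apply: cvgD; [apply: cvgZr_tmp; exact: cvg_id|exact: cvg_cst].
  rewrite scale0r add0r in c1.
  have c2 : gam (h *: 1 + s) - gam s @[h --> (0 : R)] --> gam s - gam s.
    by apply: cvgB; [exact: (cvg_comp _ _ c1 cg)|exact: cvg_cst].
  by rewrite subrr in c2.
have littleo_g : \forall h \near (0 : R), `|g (gam (h *: 1 + s) - gam s + gam s) - g (gam s) -
    \sum_(j < n) (gam (h *: 1 + s) - gam s) 0 j * 'D_(basis_dir j) g (gam s)|
    <= e1 * `|gam (h *: 1 + s) - gam s| := cgam _ (smooth_littleo (gam s) sg e10).
near=> h.
have dh : forall j : 'I_n, `|(gam (h *: 1 + s) - gam s) 0 j - h * dg 0 j| <= e2 * `|h|.
  by near: h.
have : `|g (gam (h *: 1 + s) - gam s + gam s) - g (gam s) -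
    \sum_(j < n) (gam (h *: 1 + s) - gam s) 0 j * 'D_(basis_dir j) g (gam s)|
    <= e1 * `|gam (h *: 1 + s) - gam s| by near: h.
rewrite subrK; set d := gam (h *: 1 + s) - gam s in dh * => gh.
have dle : `|d| <= (`|dg| + 1) * `|h|.
  apply: rV_norm_le => [|j]; first by rewrite mulr_ge0// addr_ge0.
  rewrite -[d 0 j](subrK (h * dg 0 j)); apply: (le_trans (ler_normD _ _)).
  rewrite addrC mulrDl; apply: lerD.
    by rewrite normrM mulrC ler_wpM2r// rV_norm_ge.
  by apply: (le_trans (dh j)); rewrite ler_wpM2r// ge_min lexx.
rewrite (_ : _ - _ - _ = (g (gam (h *: 1 + s)) - g (gam s) - \sum_(j < n) d 0 j * 'D_(basis_dir j) g (gam s))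
  + \sum_(j < n) (d 0 j - h * dg 0 j) * 'D_(basis_dir j) g (gam s)); last first.
  have -> : \sum_(j < n) (d 0 j - h * dg 0 j) * 'D_(basis_dir j) g (gam s) =
      \sum_(j < n) d 0 j * 'D_(basis_dir j) g (gam s) -
      h * \sum_(j < n) dg 0 j * 'D_(basis_dir j) g (gam s).
    by rewrite mulr_sumr -sumrB; apply: eq_bigr => j _; rewrite mulrBl mulrA.
  by ring.
apply: (le_trans (ler_normD _ _)); rewrite [in leRHS](splitr e) mulrDl; apply: lerD.
  apply: (le_trans gh); apply: (@le_trans _ _ (e1 * ((`|dg| + 1) * `|h|))).
    by rewrite ler_wpM2l// ltW.
  by rewrite mulrA /e1 divfK// gt_eqF// ltr_wpDl.
apply: (le_trans (ler_norm_sum _ _ _)).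
apply: (@le_trans _ _ (\sum_(j < n) (e2 * `|h|) * `|'D_(basis_dir j) g (gam s)|)).
  by apply: ler_sum => j _; rewrite normrM ler_wpM2r//; exact: dh.
rewrite -mulr_sumr -/X mulrAC ler_wpM2r//.
apply: (@le_trans _ _ (e / 2 / (X + 1) * X)); first by rewrite ler_wpM2r// ge_min lexx orbT.
rewrite mulrAC ler_pdivrMr ?ltr_wpDl//.
by rewrite ler_wpM2l ?(ltW e20')// lerDl.
Unshelve. all: by end_near. Qed.

End row_vectors.

(** * Smooth bump functions *)

Section bumps.
Context {R : realType}.
Implicit Types (x : R) (j k : nat).

Lemma sint_FTC (a b : R) (f F : R -> R) : a < b -> continuous f -> continuous F ->
  (forall x : R, a < x < b -> is_derive (x : R) (1 : R) F (f x)) -> sint a b f = F b - F a.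
Proof.
move=> ab cf cF dF; rewrite /sint /Rintegral (continuous_FTC2 (F := F) ab)//.
- exact: continuous_subspaceT.
- split.
  + by move=> x; rewrite in_itv/= => /dF[].
  + exact/cvg_at_right_filter/cF.
  + exact/cvg_at_left_filter/cF.
- by move=> x; rewrite in_itv/= derive1E => /dF dFx; rewrite derive_val.
Qed.

(** The powers of [1/x] make the span of these functions closed under differentiation, so smoothness
    is proved for all [j] at once by induction on the order. *)
Definition flat j x := if 0 < x then x^-1 ^+ j * expR (- x^-1) else 0.

(** One term of the exponential series, [u^(j+2) / (j+2)! <= exp u] at [u = 1/x]. The square on the
    right makes the derivative at 0 vanish. *)
Lemma flat_le j x : `|flat j x| <= (j.+2)`!%:R * x ^+ 2.
Proof.
rewrite /flat; case: ifPn => [x0|_]; last by rewrite normr0 mulr_ge0// sqr_ge0.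
have u0 : 0 < x^-1 by rewrite invr_gt0.
rewrite ger0_norm ?mulr_ge0 ?expR_ge0 ?exprn_ge0 ?(ltW u0)//.
rewrite -ler_pdivrMr ?exprn_gt0//.
rewrite -exprVn mulrAC -exprD addn2 expRN ler_pdivrMr ?expR_gt0// mulrC.
rewrite -ler_pdivrMr ?ltr0n ?fact_gt0//.
apply: le_trans (expR_ge1Dxn j.+1 (ltW u0)).
by rewrite lerDr.
Qed.

Lemma is_derive_flat j x :
  is_derive x (1 : R) (flat j) (flat j.+2 x - j%:R * flat j.+1 x).
Proof.
have [x0|x0|x0] := ltgtP 0 x.
- have dV : is_derive x (1 : R) (fun y : R => y^-1) (- x ^- 2 *: 1).
    by apply: is_deriveV; rewrite ?gt_eqF//; exact: is_derive_id.
  have dVX : is_derive x (1 : R) (fun y : R => y^-1 ^+ j) (j%:R * x^-1 ^+ j.-1 * - x^-1 ^+ 2).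
    have := is_deriveX j dV; rewrite exprfctE => /is_derive_eq; apply.
    by rewrite /GRing.scale/= mulr1 -exprVn.
  have dE : is_derive x (1 : R) (fun y : R => expR (- y^-1)) (expR (- x^-1) * x^-1 ^+ 2).
    have dN : is_derive x (1 : R) (fun y : R => - y^-1) (- (- x ^- 2 *: 1)) := is_deriveN dV.
    have dcomp := @is_derive1_comp R expR (fun y : R => - y^-1) x _ _ (is_derive_expR (- x^-1)) dN.
    apply: (is_derive_eq dcomp).
    by rewrite /GRing.scale/= mulr1 opprK exprVn.
  apply: (@near_eq_is_derive R R R (fun y : R => y^-1 ^+ j * expR (- y^-1)) (flat j) x 1).
    near=> y; rewrite /flat ifT//; near: y; exact: lt_nbhsr.
  apply: (is_derive_eq (is_deriveM dVX dE)).
  rewrite /flat x0 /GRing.scale/=.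
  case: j dVX => [|j] _; first by rewrite !expr0 !mul0r !mulr0 subr0; ring.
  by rewrite /= !exprS; ring.
- apply: (@near_eq_is_derive R R R (cst 0) (flat j) x 1).
    near=> y; rewrite /flat ifF//; apply/negbTE; rewrite -leNgt ltW//.
    by near: y; exact: lt_nbhsl.
  by rewrite /flat !ifN -?leNgt ?ltW// mulr0 subr0; exact: is_derive_cst.
- rewrite -x0 {2 3}/flat ltxx mulr0 subr0; apply/is_derive_littleo => e e0.
  pose C : R := (j.+2)`!%:R.
  have C0 : 0 < C by rewrite ltr0n fact_gt0.
  near=> h; have -> : h *: (1 : R) + 0 = h by rewrite /GRing.scale/= mulr1 addr0.
  rewrite mulr0 subr0 {2}/flat ltxx subr0.
  apply: (le_trans (flat_le _ _)); rewrite -/C -real_normK ?num_real// expr2 mulrA.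
  rewrite ler_wpM2r// -ler_pdivlMl// mulrC; apply/ltW.
  by near: h; apply: (@nbhs0_lt _ R); rewrite divr_gt0.
Unshelve. all: by end_near. Qed.

Lemma is_derive_dir (f : R -> R) (x v d : R) :
  is_derive x (1 : R) f d -> is_derive x v f (v * d).
Proof.
move=> df; have dfx : differentiable f x by apply/derivable1_diffP; case: df.
apply: DeriveDef; first exact: diff_derivable.
rewrite deriveE//; transitivity ('d f x (v *: (1 : R))).
  by rewrite [v *: _]mulr1.
by rewrite linearZ/= -deriveE// derive_val.
Qed.

Lemma smooth_flat j : smooth (flat j).
Proof.
move=> k; elim: k j => [|k IH] j.
  split=> //; apply: continuous_snd_comp => x; apply: differentiable_continuous.
  by apply/derivable1_diffP; case: (is_derive_flat j x).
split.
  apply: continuous_snd_comp => x; apply: differentiable_continuous.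
  by apply/derivable1_diffP; case: (is_derive_flat j x).
move=> v; exists (fun _ x => v * (flat j.+2 x + (- j%:R) * flat j.+1 x)).
  by move=> _ x; rewrite mulNr; apply: is_derive_dir; exact: is_derive_flat.
have Cc c : Ck_family k (fun (_ : R) (_ : R) => c).
  by apply: Ck_family_cst; exact: cst_continuous.
by apply: Ck_familyM => //; apply: Ck_familyD => //; exact: Ck_familyM.
Qed.

(** The usual smooth transition from 0 to 1 over the unit interval; [x] and [1 - x] are never both
    nonpositive, so the denominator is positive. *)
Definition step x := flat 0 x / (flat 0 x + flat 0 (1 - x)).

Lemma flat0_gt0 x : 0 < x -> 0 < flat 0 x.
Proof. by move=> x0; rewrite /flat x0 expr0 mul1r expR_gt0. Qed.

Lemma flat0_ge0 x : 0 <= flat 0 x.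
Proof. by rewrite /flat; case: ifP => // _; rewrite expr0 mul1r expR_ge0. Qed.

Lemma smooth_reflect (f : R -> R) c : smooth f -> smooth (fun x => f (c - x)).
Proof.
move=> sf; under eq_fun do (rewrite -opprB -scaleN1r).
by apply: (@smooth_affine R R R f id (-1) c) => // x; exact: cvg_id.
Qed.

Lemma smooth_step : smooth step.
Proof.
apply: smoothM; first exact: smooth_flat.
move=> k; apply: Ck_familyV; last first.
  apply: smoothD; first exact: smooth_flat.
  by apply: smooth_reflect; exact: smooth_flat.
move=> _ x; rewrite gt_eqF//; have [x0|x0] := ltP 0 x.
  by rewrite ltr_pwDl ?flat0_gt0// flat0_ge0.
by rewrite ltr_wpDl ?flat0_ge0// flat0_gt0//; lra.
Qed.

Lemma step_ge0 x : 0 <= step x.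
Proof. by rewrite divr_ge0 ?addr_ge0 ?flat0_ge0. Qed.

Lemma step_eq0 x : x <= 0 -> step x = 0.
Proof. by move=> x0; rewrite /step {1}/flat ltNge x0 mul0r. Qed.

Lemma step_eq1 x : 1 <= x -> step x = 1.
Proof.
move=> x1; rewrite /step {3}/flat ifF; last by apply/negbTE; lra.
by rewrite addr0 divff// gt_eqF// flat0_gt0//; lra.
Qed.

(** The plateau is [[-1, 1]] and the support lies in [[-2, 2]]; hence the endpoints [s0 - 2 * r] and
    [s0 + 2 * r] in later integrals against a bump of width [r]. *)
Definition bump1 x := step (2 - x) * step (2 + x).

Lemma smooth_bump1 : smooth bump1.
Proof.
apply: smoothM; first by apply: smooth_reflect; exact: smooth_step.
rewrite (_ : (fun x => step (2 + x)) = fun x => step (1 *: (x - (-2)))).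
  by apply: (@smooth_affine R R R step id 1 (-2)) => //; [by move=> z; exact: cvg_id|exact: smooth_step].
by apply/funext => x; rewrite scale1r opprK addrC.
Qed.

Lemma bump1_ge0 x : 0 <= bump1 x.
Proof. by rewrite mulr_ge0 ?step_ge0. Qed.

Lemma bump1_eq1 x : `|x| <= 1 -> bump1 x = 1.
Proof. by rewrite ler_norml => /andP[? ?]; rewrite /bump1 !step_eq1 ?mulr1//; lra. Qed.

Lemma bump1_eq0 x : 2 <= `|x| -> bump1 x = 0.
Proof.
rewrite /bump1; case: (ger0P x) => x0 x2.
  by rewrite step_eq0 ?mul0r//; lra.
by rewrite [X in _ * X]step_eq0 ?mulr0//; lra.
Qed.

End bumps.

Lemma smooth_dilate {R : realType} {W : normedModType R} (f : W -> R) (c : R) b :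
  smooth f -> smooth (fun x => f (c *: (x - b))).
Proof. by move=> sf; apply: (@smooth_affine R W W f id c b) => // x; exact: cvg_id. Qed.

(** * Two uniqueness lemmas for scalar integrals *)

Section scalar_uniqueness.
Context {R : realType}.
Implicit Types (f nu : R -> R) (a b : R).

(** Common tool of the two uniqueness lemmas: a good lower bound [m] on a middle piece must outweigh
    the crude bound [- M] on the rest. *)
Lemma sint_lower a b a' b' f M m : continuous f -> a <= a' -> a' <= b' -> b' <= b ->
  0 <= M -> (forall t, a <= t <= b -> - M <= f t) ->
  (forall t, a' <= t <= b' -> m <= f t) ->
  m * (b' - a') - M * (b - a) <= sint a b f.
Proof.
move=> cf aa' a'b' b'b M0 fM fm.
rewrite (sint_split cf aa' (le_trans a'b' b'b)) (sint_split cf a'b' b'b).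
have h1 : (- M) * (a' - a) <= sint a a' f.
  rewrite -sint_cst//; apply: sint_le => //; first exact: cst_continuous.
  by move=> t /andP[? ?]; apply: fM; lra.
have h2 : m * (b' - a') <= sint a' b' f.
  by rewrite -sint_cst//; apply: sint_le => //; exact: cst_continuous.
have h3 : (- M) * (b - b') <= sint b' b f.
  rewrite -sint_cst//; apply: sint_le => //; first exact: cst_continuous.
  by move=> t /andP[? ?]; apply: fM; lra.
have : 0 <= M * (b' - a') by rewrite mulr_ge0// subr_ge0.
by rewrite -subr_ge0 in h1 h2 h3 *; nra.
Qed.

Lemma continuous_pos_near f t0 : {for t0, continuous f} -> 0 < f t0 ->
  exists2 d, 0 < d & forall t, `|t - t0| <= d -> f t0 / 2 <= f t.
Proof.
move=> /cvgrPdist_lt cf f0; have /cf/nbhs_ballP[d /= d0 H] : 0 < f t0 / 2 by rewrite divr_gt0.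
exists (d / 2); first by rewrite divr_gt0.
move=> t td; have /H : ball t0 d t by rewrite -ball_normE/= distrC; lra.
by rewrite /= ltr_norml => /andP[_]; lra.
Qed.

Lemma continuous_bounded_segment a b f : a <= b -> continuous f ->
  exists2 M, 0 <= M & forall t, a <= t <= b -> `|f t| <= M.
Proof.
move=> ab cf; have [|c _ fc] := @EVT_max _ (fun t => `|f t|) a b ab.
  by apply: continuous_subspaceT => t; apply: cvg_norm; exact: cf.
by exists `|f c| => // t tab; apply: fc; rewrite in_itv.
Qed.

(** No limit is taken: if [f s0 > 0], a single [r], small enough that [f] exceeds [f s0 / 2] on the
    support of the bump, makes the integral positive. Applying this to [- f] excludes the other
    sign. *)
Lemma bump_integral_eq0 f s0 r0 : continuous f -> 0 < r0 ->
  (forall r, 0 < r < r0 ->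
     sint (s0 - 2 * r) (s0 + 2 * r) (fun s => bump1 (r^-1 * (s - s0)) * f s) = 0) ->
  f s0 = 0.
Proof.
have key g : continuous g -> 0 < r0 ->
  (forall r, 0 < r < r0 ->
     sint (s0 - 2 * r) (s0 + 2 * r) (fun s => bump1 (r^-1 * (s - s0)) * g s) = 0) ->
  g s0 <= 0.
  move=> cg r00 H; rewrite leNgt; apply/negP => g0.
  have [d d0 gd] := continuous_pos_near (cg s0) g0.
  pose r := Order.min (d / 2) (r0 / 2).
  have rE : [/\ 0 < r, r <= d / 2 & r <= r0 / 2].
    by rewrite lt_min !divr_gt0//= ge_min lexx ge_min lexx orbT.
  have [r_gt0 rd rr0] := rE.
  have := @sint_lower (s0 - 2 * r) (s0 + 2 * r) (s0 - r) (s0 + r)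
    (fun s => bump1 (r^-1 * (s - s0)) * g s) 0 (g s0 / 2).
  rewrite H; last by rewrite r_gt0; lra.
  move=> /(_ _)/wrap[].
    move=> s; apply: cvgM; last exact: cg.
    apply: (@continuous_comp _ _ _ (fun s => r^-1 * (s - s0)) bump1); last first.
      by apply: smooth_continuous; exact: smooth_bump1.
    by apply: cvgM; [exact: cvg_cst|apply: cvgB; [exact: cvg_id|exact: cvg_cst]].
  have : 0 < g s0 * r by rewrite mulr_gt0.
  move=> gr h; suff : g s0 / 2 * (s0 + r - (s0 - r)) - 0 * (s0 + 2 * r - (s0 - 2 * r)) <= 0.
    by nra.
  apply: h; [lra|lra|lra|by []| |].
    move=> t /andP[? ?]; rewrite oppr0 mulr_ge0 ?bump1_ge0//.
    apply: (@le_trans _ _ (g s0 / 2)); first by rewrite divr_ge0// ltW.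
    by apply: gd; rewrite ler_norml; lra.
  move=> t /andP[? ?]; rewrite bump1_eq1 ?mul1r; first by apply: gd; rewrite ler_norml; lra.
  by rewrite normrM gtr0_norm ?invr_gt0// ler_pdivrMl// mulr1 ler_norml; lra.
move=> cf r00 H; apply/eqP; rewrite eq_le key//= -oppr_le0.
apply: (key (fun s => - f s)) => //; first by move=> s; apply: cvgN; exact: cf.
move=> r /H {}H; under [X in sint _ _ X]eq_fun do rewrite mulrN -mulN1r.
rewrite sintZ ?H ?mulr0// => s; apply: cvgM; last exact: cf.
apply: (@continuous_comp _ _ _ (fun s => r^-1 * (s - s0)) bump1); last first.
  by apply: smooth_continuous; exact: smooth_bump1.
by apply: cvgM; [exact: cvg_cst|apply: cvgB; [exact: cvg_id|exact: cvg_cst]].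
Qed.

Lemma bernoulli_ineq (x : R) N : 0 <= x -> 1 + N%:R * x <= (1 + x) ^+ N.
Proof.
move=> x0; elim: N => [|N IH]; first by rewrite mul0r addr0 expr0.
rewrite exprS; apply: (@le_trans _ _ ((1 + x) * (1 + N%:R * x))).
  have : 0 <= N%:R * x * x by rewrite !mulr_ge0.
  by rewrite -natr1; nra.
by rewrite ler_wpM2l// addr_ge0.
Qed.

(* Were [nu t0 > 0], integrate [nu] against the powers of a quadratic polynomial
   that exceeds 1 exactly near [t0] and stays in [[0, 1]] elsewhere. *)
Lemma moments_eq0 a b nu t0 : continuous nu -> a < t0 < b ->
  (forall k, sint a b (fun t => t ^+ k * nu t) = 0) -> nu t0 = 0.
Proof.
have key (g : R -> R) : continuous g -> a < t0 < b ->
  (forall k, sint a b (fun t => t ^+ k * g t) = 0) -> g t0 <= 0.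
  move=> cg /andP[at0 t0b] H; rewrite leNgt; apply/negP => g0.
  have ab : a < b by apply: lt_trans t0b.
  have cX k : continuous (fun t : R => t ^+ k) by move=> t; exact: exprn_continuous.
  have sumg n (c : nat -> R) :
      sint a b (fun t : R => (\sum_(i < n) c i * t ^+ i) * g t) = 0 /\
      continuous (fun t : R => (\sum_(i < n) c i * t ^+ i) * g t).
    elim: n => [|n [IH cIH]].
      under eq_fun do rewrite big_ord0 mul0r.
      by split; [exact: sint0|exact: cst_continuous].
    have cn : continuous (fun t : R => t ^+ n * g t) by move=> t; apply: cvgM; [exact: cX|exact: cg].
    have ccn : continuous (fun t : R => c n * (t ^+ n * g t)).
      by move=> t; apply: cvgM; [exact: cvg_cst|exact: cn].
    under eq_fun do rewrite big_ord_recr/= mulrDl -[c n * _ * _]mulrA.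
    split; first by rewrite sintD// IH sintZ// H mulr0 addr0.
    by move=> t; apply: cvgD; [exact: cIH|exact: ccn].
  have polyg (p : {poly R}) : sint a b (fun t => p.[t] * g t) = 0 /\
      continuous (fun t : R => p.[t] * g t).
    by under eq_fun do rewrite horner_coef; exact: (sumg (size p) (fun i => p`_i)).
  have [d0 d0_gt0 gd0] := continuous_pos_near (cg t0) g0.
  have [M M0 gM] := continuous_bounded_segment (ltW ab) cg.
  pose d := Order.min d0 (Order.min (t0 - a) (b - t0)).
  have d_gt0 : 0 < d by rewrite !lt_min d0_gt0 !subr_gt0 at0 t0b.
  have [dd0 da db] : [/\ d <= d0, d <= t0 - a & d <= b - t0].
    by rewrite /d !ge_min !lexx !orbT.
  have L0 : 0 < (b - a) ^+ 2 by rewrite exprn_gt0// subr_gt0.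
  pose D := ((b - a) ^+ 2)^-1.
  have D0 : 0 < D by rewrite invr_gt0.
  (* [q] is [1 + D * (d^2 - (t - t0)^2)]: it exceeds 1 exactly when [|t - t0| < d], and the choice
     [D = (b - a)^-2] keeps it nonnegative on [[a, b]]. *)
  pose q : {poly R} := (1 + D * d ^+ 2)%:P - D *: ('X - t0%:P) ^+ 2.
  have qE t : q.[t] = 1 + D * (d ^+ 2 - (t - t0) ^+ 2).
    by rewrite /q hornerD hornerN hornerC hornerZ horner_exp hornerXsubC; ring.
  (* For [|t - t0| <= d / 2], [q - 1] is at least [kap], so by Bernoulli [q ^+ N] grows there at
     least linearly in [N], while the remaining part of the integral never falls below
     [- M * (b - a)]. *)
  pose kap := D * (d ^+ 2 * (3 / 4)).
  have kap0 : 0 < kap by rewrite !mulr_gt0// exprn_gt0.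
  have bound N : g t0 / 2 * (1 + N%:R * kap) * d <= M * (b - a).
    have [qN0 cqN] := polyg (q ^+ N).
    rewrite -subr_le0 -qN0.
    have -> : d = (t0 + d / 2) - (t0 - d / 2) by field.
    apply: sint_lower => //; [lra|lra|lra| |].
      move=> t tab; rewrite horner_exp.
      have q0 : 0 <= q.[t].
        have D1 : D * (b - a) ^+ 2 = 1 by rewrite mulVf// gt_eqF.
        rewrite qE -D1 -mulrDr mulr_ge0 ?(ltW D0)//.
        have d2 := sqr_ge0 d; move/andP: tab => [ta tb].
        have : 0 <= (b - a - (t - t0)) * (b - a + (t - t0)) by rewrite mulr_ge0//; lra.
        move=> h; have -> : (b - a) ^+ 2 + (d ^+ 2 - (t - t0) ^+ 2) =
          d ^+ 2 + (b - a - (t - t0)) * (b - a + (t - t0)) by ring.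
        by rewrite addr_ge0.
      have [td|td] := lerP `|t - t0| d.
        apply: (@le_trans _ _ 0); first by rewrite oppr_le0.
        rewrite mulr_ge0 ?exprn_ge0//; apply: (@le_trans _ _ (g t0 / 2)).
          by rewrite divr_ge0// ltW.
        exact/gd0/(le_trans td).
      have q1 : q.[t] <= 1.
        rewrite qE gerDl pmulr_rle0// subr_le0 -[leRHS]real_normK ?num_real//.
        by rewrite ler_sqr ?nnegrE ?(ltW d_gt0)// ltW.
      have : `|q.[t] ^+ N * g t| <= M.
        rewrite normrM -[M]mul1r ler_pM// ?gM//.
        by rewrite ger0_norm ?exprn_ge0// exprn_ile1.
      by rewrite ler_norml => /andP[].
    move=> t /andP[t1 t2]; rewrite horner_exp mulrC; apply: ler_pM.
    - by rewrite addr_ge0// mulr_ge0// ltW.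
    - by rewrite divr_ge0// ltW.
    - apply: le_trans (bernoulli_ineq N (ltW kap0)) _.
      apply: lerXn2r; rewrite ?nnegrE.
      + by rewrite addr_ge0// ltW.
      + by rewrite qE addr_ge0// mulr_ge0 ?(ltW D0)//; nra.
      + by rewrite qE lerD2l /kap ler_pM2l//; nra.
    - by apply: gd0; rewrite ler_norml; lra.
  pose e := g t0 / 2 * kap * d.
  have e0 : 0 < e by rewrite !mulr_gt0// divr_gt0.
  have := @archi_boundP _ (M * (b - a) / e) _.
  rewrite divr_ge0 ?(ltW e0) ?mulr_ge0 ?subr_ge0 ?(ltW ab)// => /(_ isT).
  rewrite ltr_pdivrMr// => h; have := bound (Num.bound (M * (b - a) / e)).
  rewrite leNgt => /negP; apply; apply: (lt_le_trans h).
  set N := Num.bound _; rewrite -subr_ge0.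
  have -> : g t0 / 2 * (1 + N%:R * kap) * d - N%:R * e = g t0 / 2 * d by rewrite /e; ring.
  by rewrite mulr_ge0 ?divr_ge0// ltW.
move=> cnu t0ab H; apply/eqP; rewrite eq_le key//= -oppr_le0.
apply: (key (fun t => - nu t)) => //; first by move=> t; apply: cvgN; exact: cnu.
move=> k; under eq_fun do rewrite mulrN -mulN1r.
rewrite sintZ ?H ?mulr0// => t; apply: cvgM; last exact: cnu.
exact: exprn_continuous.
Qed.
End scalar_uniqueness.

(** * Functionals of finite order *)

Section smooth_functional.
Context {R : realType} {n : nat}.
Local Notation V := 'rV[R]_n.
Implicit Types (u v : V -> R) (K : set V).

(** The bounds are imposed on [K] only, and the innermost derivative is taken first, so that
    inductions on [N] replace [u] by one of its partial derivatives. *)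
Fixpoint derivs_le N K (M : R) u : Prop :=
  (forall y, K y -> `|u y| <= M) /\
  if N is N'.+1 then forall i : 'I_n, derivs_le N' K M ('D_(basis_dir i) u) else True.

(** In essence a real distribution of compact support and finite order, acting on all smooth
    functions, with its continuity estimate taken over [K]. *)
Definition smooth_functional K (Lam : (V -> R) -> R) : Prop :=
  (forall c u v, smooth u -> smooth v ->
     Lam (fun x => c * u x + v x) = c * Lam u + Lam v) /\
  exists N C, 0 <= C /\ forall u M, smooth u -> 0 <= M -> derivs_le N K M u ->
    `|Lam u| <= C * M.

Lemma derive_smoothB u v x w : smooth u -> smooth v ->
  'D_w (fun y => u y - v y) x = 'D_w u x - 'D_w v x.
Proof.
move=> su sv; have := is_deriveB (smooth_is_derive x w su) (smooth_is_derive x w sv).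
by move=> H; exact: (derive_val (is_derive := H)).
Qed.

Lemma derivs_leB N K M1 M2 u v : smooth u -> smooth v ->
  derivs_le N K M1 u -> derivs_le N K M2 v ->
  derivs_le N K (M1 + M2) (fun y => u y - v y).
Proof.
elim: N u v => [|N IH] u v su sv [u0 uD] [v0 vD]; (split=> //;
  first by move=> y Ky; apply: le_trans (ler_normB _ _) _; apply: lerD; [exact: u0|exact: v0]).
move=> i; rewrite (_ : 'D_(basis_dir i) _ =
    fun y => 'D_(basis_dir i) u y - 'D_(basis_dir i) v y).
  by apply: IH; [exact: smooth_derive..|exact: uD|exact: vD].
by apply/funext => y; exact: derive_smoothB.
Qed.

Lemma derivs_le_sint N K M a b (Phi : R -> V -> R) : a <= b -> smooth_family Phi ->
  (forall t, a <= t <= b -> derivs_le N K M (Phi t)) ->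
  derivs_le N K (M * (b - a)) (fun y => sint a b (fun t => Phi t y)).
Proof.
move=> ab; elim: N Phi => [|N IH] Phi sPhi PhiM; (split=> //;
  first by move=> y Ky; apply: sint_norm_le => //;
    [exact: (continuous_slice2 (F := Phi) (Ck_family_continuous (sPhi 0%N)))
    |by move=> t /PhiM[+ _]; apply]).
move=> i; pose Phi' t y := 'D_(basis_dir i) (Phi t) y.
have sPhi' : smooth_family Phi' by exact: smooth_family_derive.
rewrite (_ : 'D_(basis_dir i) _ = fun y => sint a b (fun t => Phi' t y)).
  by apply: IH => // t /PhiM[_]; exact.
apply/funext => y; apply: derive_val.
apply: is_derive_sint_family => //; first exact: (Ck_family_continuous (sPhi 0%N)).
  exact: (Ck_family_continuous (sPhi' 0%N)).
by move=> t z; exact: smooth_family_is_derive.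
Qed.

(** Joint continuity of the derivatives, made uniform over the compact [K]: a smooth family depends
    continuously on its parameter for the seminorm that controls a functional. *)
Lemma near_derivs_le {P : topologicalType} N K (Phi : P -> V -> R) p0 e :
  compact K -> smooth_family Phi -> 0 < e ->
  \forall p \near p0, derivs_le N K e (fun y => Phi p y - Phi p0 y).
Proof.
move=> cK + e0; elim: N Phi => [|N IH] Phi sPhi.
  have cPhi := Ck_family_continuous (sPhi 0%N).
  have := @compact_near_uniform _ _ _ K Phi p0 e cK e0 (fun t _ => cPhi (p0, t)).
  by apply: filterS => p H; split=> // y Ky; exact/ltW/H.
have cPhi := Ck_family_continuous (sPhi 0%N).
have H0 := @compact_near_uniform _ _ _ K Phi p0 e cK e0 (fun t _ => cPhi (p0, t)).
have H1 : \forall p \near p0, forall i : 'I_n,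
    derivs_le N K e (fun y => 'D_(basis_dir i) (Phi p) y - 'D_(basis_dir i) (Phi p0) y).
  apply: (@filter_forall _ 'I_n _ (nbhs p0)) => i.
  exact: IH (smooth_family_derive (basis_dir i) sPhi).
apply: filterS2 H0 H1 => p H0 H1; split=> [y Ky|i]; first exact/ltW/H0.
rewrite (_ : 'D_(basis_dir i) _ =
    fun y => 'D_(basis_dir i) (Phi p) y - 'D_(basis_dir i) (Phi p0) y) //.
by apply/funext => y; apply: derive_smoothB; exact: smooth_family_smooth.
Qed.

Section commute_sint.
Variables (K : set V) (Lam : (V -> R) -> R).
Hypotheses (cK : compact K) (LamP : smooth_functional K Lam).

Lemma functional0 : Lam (fun=> 0) = 0.
Proof.
have [lin _] := LamP; have := lin 1 (fun=> 0) (fun=> 0) (smooth_cst 0) (smooth_cst 0).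
have -> : (fun _ : V => 1 * 0 + 0) = (fun=> 0 : R) by apply/funext => x; rewrite mulr0 addr0.
by rewrite mul1r => /eqP; rewrite -subr_eq subrr eq_sym => /eqP.
Qed.

Lemma functionalZ c u : smooth u -> Lam (fun x => c * u x) = c * Lam u.
Proof.
move=> su; have [lin _] := LamP; have := lin c u (fun=> 0) su (smooth_cst 0).
by under eq_fun do rewrite addr0; rewrite functional0 addr0.
Qed.

Lemma functionalD u v : smooth u -> smooth v -> Lam (fun x => u x + v x) = Lam u + Lam v.
Proof.
move=> su sv; have [lin _] := LamP; have := lin 1 u v su sv.
by under eq_fun do rewrite mul1r; rewrite mul1r.
Qed.

Lemma functionalB u v : smooth u -> smooth v -> Lam (fun x => u x - v x) = Lam u - Lam v.
Proof.
move=> su sv; under eq_fun do rewrite -[- v _]mulN1r.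
rewrite functionalD//; last by apply: smoothM => //; exact: smooth_cst.
by rewrite functionalZ// mulN1r.
Qed.

Lemma functional_sum (T : Type) (r : seq T) (f : T -> V -> R) :
  (forall i, smooth (f i)) -> Lam (fun x => \sum_(i <- r) f i x) = \sum_(i <- r) Lam (f i).
Proof.
move=> sf; elim: r => [|i r IH].
  by under eq_fun do rewrite big_nil; rewrite big_nil functional0.
under eq_fun do rewrite big_cons.
by rewrite functionalD ?IH ?big_cons//; exact: smooth_sum.
Qed.

Lemma functional_continuous {P : topologicalType} (Phi : P -> V -> R) :
  smooth_family Phi -> continuous (fun p => Lam (Phi p)).
Proof.
move=> sPhi p0; apply/cvgrPdist_le => e e0.
have [_ [N [C [C0 bnd]]]] := LamP.
have e'0 : 0 < e / (C + 1) by rewrite divr_gt0// ltr_wpDl.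
have := near_derivs_le N p0 cK sPhi e'0; apply: filterS => p Hp.
have sPp q : smooth (Phi q) by exact: smooth_family_smooth.
rewrite distrC -functionalB//.
apply: (le_trans (bnd _ (e / (C + 1)) _ (ltW e'0) Hp)); first exact: smoothB.
rewrite mulrCA ler_piMr ?(ltW e0)//.
by rewrite ler_pdivrMr ?mul1r ?lerDl// ltr_wpDl.
Qed.

(** The defect [X] of the exchange is additive over adjacent segments and, on a short one, at most a
    small multiple of its length. Adding up gives [|X a b| <= 2 * C * e * (b - a)] for every
    [e > 0]; this takes the place of the convergence of Riemann sums. *)
Lemma functional_sint a b (Phi : R -> V -> R) : a <= b -> smooth_family Phi ->
  Lam (fun x => sint a b (fun t => Phi t x)) = sint a b (fun t => Lam (Phi t)).
Proof.
move=> ab sPhi; have [_ [N [C [C0 bnd]]]] := LamP.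
have cLam := functional_continuous sPhi.
have sPp q : smooth (Phi q) by exact: smooth_family_smooth.
have cPhi y : continuous (Phi ^~ y).
  exact: (continuous_slice2 (F := Phi) (Ck_family_continuous (sPhi 0%N))).
have sint_smooth c d : c <= d -> smooth (fun x => sint c d (fun t => Phi t x)).
  by move=> cd; exact: smooth_sint.
pose X c d := Lam (fun x => sint c d (fun t => Phi t x)) - sint c d (fun t => Lam (Phi t)).
(* The exchange is exact for the constant family [Phi c], so only [Phi t - Phi c] counts; it enters
   once under [Lam] and once under the integral, whence the factor 2. *)
have Xlocal e c d : 0 < e -> c <= d ->
    (forall t, c <= t <= d -> derivs_le N K e (fun y => Phi t y - Phi c y)) ->
    `|X c d| <= 2 * C * e * (d - c).
  move=> e0 cd He.
  have sB : smooth_family (fun t y => Phi t y - Phi c y).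
    move=> k; apply: Ck_familyD => //.
    exact: (Ck_family_reparam (theta := fun=> c) (@cst_continuous _ _ _)
      (smooth_family_const (smoothN (sPp c)) k)).
  rewrite (_ : X c d = Lam (fun x => sint c d (fun t => Phi t x - Phi c x))
      - sint c d (fun t => Lam (Phi t) - Lam (Phi c))); last first.
    have -> : (fun x => sint c d (fun t => Phi t x - Phi c x)) =
        fun x => sint c d (fun t => Phi t x) - (d - c) * Phi c x.
      apply/funext => x; rewrite sintB ?sint_cst//; first by rewrite mulrC.
      exact: cst_continuous.
    rewrite sintB// ?sint_cst//; last exact: cst_continuous.
    rewrite functionalB//; [|exact: sint_smooth|by apply: smoothM => //; exact: smooth_cst].
    by rewrite functionalZ// /X; ring.
  apply: (le_trans (ler_normB _ _)).
  rewrite (_ : 2 * C * e * (d - c) = C * (e * (d - c)) + C * e * (d - c)); last by ring.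
  apply: lerD.
    apply: bnd; [|by rewrite mulr_ge0 ?(ltW e0)// subr_ge0|exact: derivs_le_sint].
    exact: smooth_sint.
  apply: sint_norm_le => //.
    by move=> t; apply: cvgB; [exact: cLam|exact: cvg_cst].
  move=> t tcd; rewrite -functionalB//; apply: bnd; [exact: smoothB|exact: ltW|exact: He].
have Xadd c d m : c <= d -> d <= m -> X c m = X c d + X d m.
  move=> cd dm; rewrite /X (sint_split (b := d))//.
  have -> : (fun x => sint c m (fun t => Phi t x)) =
      fun x => sint c d (fun t => Phi t x) + sint d m (fun t => Phi t x).
    by apply/funext => x; rewrite (sint_split (b := d)).
  by rewrite functionalD; [ring|exact: sint_smooth..].
(* Uniform continuity of [t |-> Phi t] on [[a, b]] by a Lebesgue number: half of the radius found at
   [c0] is spent on [c - c0], the other half on [t - c]. *)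
have unif e : 0 < e -> exists2 r, 0 < r & forall c t, a <= c <= b -> `|t - c| < r ->
    derivs_le N K e (fun y => Phi t y - Phi c y).
  move=> e0; have e20 : 0 < e / 2 by rewrite divr_gt0.
  have /compact_near_coveringP cab := @segment_compact R a b.
  have := cab R (nbhs (0 : R)^'+) (fun r c => forall t, `|t - c| < r ->
    derivs_le N K e (fun y => Phi t y - Phi c y)) _.
  case=> [c0 _|r /= r0 H].
    have /nbhs_ballP[r /= r0 Hr] := near_derivs_le N c0 cK sPhi e20.
    have r20 : 0 < r / 2 by rewrite divr_gt0.
    exists (ball c0 (r / 2), [set x | x < r / 2]).
      split=> /=; first exact: nbhsx_ballx.
      exact: nbhs_right_lt.
    move=> -[c x] /= [c0c xr] t tc.
    have -> : (fun y => Phi t y - Phi c y) =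
        fun y => (Phi t y - Phi c0 y) - (Phi c y - Phi c0 y).
      by apply/funext => y; ring.
    rewrite (splitr e); apply: derivs_leB; [exact: smoothB|exact: smoothB| |].
      apply: Hr; rewrite -ball_normE/= in c0c *.
      rewrite (_ : c0 - t = (c0 - c) - (t - c)); last by ring.
      apply: (le_lt_trans (ler_normB _ _)); lra.
    by apply: Hr; apply: le_ball c0c; lra.
  exists (r / 2); first by rewrite divr_gt0.
  move=> c t cab' tc; apply: (H (r / 2)) => //=.
    by rewrite sub0r normrN gtr0_norm ?divr_gt0//; lra.
  by rewrite divr_gt0.
have Xle e : 0 < e -> `|X a b| <= 2 * C * e * (b - a).
  move=> e0; have [r r0 Hr] := unif e e0.
  have r20 : 0 < r / 2 by rewrite divr_gt0.
  (* Pieces of length [r / 2] are cut off at the right end; [m] bounds their number. *)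
  have step m : forall d, a <= d -> d <= b -> d - a <= m%:R * (r / 2) ->
      `|X a d| <= 2 * C * e * (d - a).
    elim: m => [|m IH] d ad db dm.
      rewrite mul0r in dm; apply: Xlocal => // t tad; apply: Hr; first by lra.
      by rewrite ger0_norm; lra.
    have [dr|dr] := lerP (d - a) (r / 2).
      apply: Xlocal => // t tad; apply: Hr; first by lra.
      by rewrite ger0_norm; lra.
    rewrite (@Xadd a (d - r / 2) d); [|lra|lra].
    rewrite (_ : _ * (d - a) = 2 * C * e * (d - r / 2 - a) + 2 * C * e * (d - (d - r / 2))); last by ring.
    apply: (le_trans (ler_normD _ _)); apply: lerD.
      apply: IH; [lra|lra|].
      by move: dm; rewrite -natr1 mulrDl mul1r; lra.
    apply: Xlocal => //; first by lra.
    move=> t tad; apply: Hr; first by lra.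
    by rewrite ger0_norm; lra.
  have := @archi_boundP _ ((b - a) / (r / 2)) _.
  rewrite divr_ge0 ?(ltW r20) ?subr_ge0// => /(_ isT).
  by rewrite ltr_pdivrMr// => /ltW h; apply: (step _ b ab (lexx b) h).
apply/eqP; rewrite -subr_eq0 -/(X a b) -normr_le0; apply/ler_addgt0Pr => e e0.
have c0 : 0 <= 2 * C * (b - a) by rewrite !mulr_ge0// subr_ge0.
have e'0 : 0 < e / (2 * C * (b - a) + 1) by rewrite divr_gt0// ltr_wpDl.
rewrite add0r; apply: (le_trans (Xle _ e'0)).
rewrite mulrAC mulrCA ler_piMr ?(ltW e0)//.
by rewrite ler_pdivrMr ?mul1r ?lerDl// ltr_wpDl.
Qed.
End commute_sint.
End smooth_functional.

(** * Localisation of distributions *)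

Section bump_functions.
Context {R : realType} {n : nat}.
Local Notation V := 'rV[R]_n.

(** The norm on row vectors is the sup norm, so a product of one-variable bumps is adapted to its
    balls: 1 on the ball of radius [r], 0 outside that of radius [2 * r]. *)
Definition bump (c : V) (r : R) (x : V) : R :=
  \prod_(j < n) bump1 (r^-1 *: (x 0 j - c 0 j)).

Lemma smooth_bump c r : smooth (bump c r).
Proof.
apply: smooth_prod => j.
apply: (smooth_affine (L := fun x : 'rV[R]_n => x 0 j)).
- exact: coord_continuous.
- by move=> h u w; rewrite !mxE.
- exact: smooth_bump1.
Qed.

Lemma bump_eq1 c r x : 0 < r -> `|x - c| <= r -> bump c r x = 1.
Proof.
move=> r0 xc; apply: big1 => j _; apply: bump1_eq1.
rewrite normrM gtr0_norm ?invr_gt0// ler_pdivrMl// mulr1; apply: le_trans xc.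
by have := rV_norm_ge (x - c) j; rewrite !mxE.
Qed.

Lemma bump_eq0 c r x : 0 < r -> 2 * r <= `|x - c| -> bump c r x = 0.
Proof.
move=> r0 xc; have [j cj] : exists j, 2 * r <= `|x 0 j - c 0 j|.
  apply/not_existsP => xj; suff : `|x - c| < 2 * r by rewrite ltNge xc.
  apply: rV_norm_lt => [|j]; first by rewrite mulr_gt0.
  by rewrite !mxE ltNge; apply/negP/xj.
apply/eqP/prodf_eq0; exists j => //; apply/eqP/bump1_eq0.
by rewrite normrM gtr0_norm ?invr_gt0// ler_pdivlMl// mulrC.
Qed.

Definition cball (c : V) r : set V := [set x | `|x - c| <= r].

Lemma continuous_dist (c : V) : continuous (fun x : V => `|x - c|).
Proof.
move=> x; apply: (@continuous_comp _ _ _ (fun x : V => x - c) (@Num.norm R V)).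
  by apply: (@cvgB _ _ _ (nbhs x)); [exact: cvg_id|exact: cvg_cst].
exact: norm_continuous.
Qed.

Lemma open_dist_lt (c : V) r : open [set x : V | `|x - c| < r].
Proof.
apply: (@open_comp _ _ (fun z : V => `|z - c|) [set z | z < r]); last exact: open_lt.
by move=> z _; exact: continuous_dist.
Qed.

Lemma cball_closed c r : closed (cball c r).
Proof.
apply: (@closed_comp _ _ (fun x : V => `|x - c|) [set x | x <= r]); last exact: closed_le.
by move=> x _; exact: continuous_dist.
Qed.

Lemma cball_compact c r : compact (cball c r).
Proof.
apply: bounded_closed_compact; last exact: cball_closed.
exists (`|c| + r); split; first exact: num_real.
move=> M Mc x; rewrite /cball/= => xc; rewrite -(subrK c x); apply: (le_trans (ler_normD _ _)); lra.
Qed.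

Lemma cball_nbhs (O : set V) c : open O -> O c -> exists2 r, 0 < r & cball c r `<=` O.
Proof.
move=> oO Oc; have /nbhs_ballP[e /= e0 He] : nbhs c O by exact: open_nbhs_nbhs.
exists (e / 2); first by rewrite divr_gt0.
by move=> x; rewrite /cball/= => xc; apply: He; rewrite -ball_normE/= distrC; lra.
Qed.

Lemma compact_finite_balls (K : set V) (r : V -> R) : compact K ->
  (forall x, K x -> 0 < r x) ->
  exists s : seq V, (forall x, x \in s -> K x) /\
    forall y, K y -> exists2 x, x \in s & `|y - x| < r x.
Proof.
rewrite compact_cover => cK r0.
have [|y Ky|D' D'K Kcov] := cK V K (fun x => ball x (r x)).
- by move=> x Kx; exact: ball_open.
- by exists y => //; apply: ballxx; exact: r0.
exists (finmap.enum_fset D'); split=> [x /D'K|y /Kcov[x /= xD]]; first by rewrite inE.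
by rewrite -ball_normE/= distrC => xy; exists x.
Qed.

End bump_functions.

Section complex_valued.
Context {R : realType} {W : normedModType R}.
Implicit Types f g : W -> R[i].

Definition smoothC f :=
  smooth (fun x => complex.Re (f x)) /\ smooth (fun x => complex.Im (f x)).

Lemma smooth_onP f : smooth_on setT f <-> smoothC f.
Proof. by split=> -[] /smooth_realP ? /smooth_realP. Qed.

Lemma smoothC_real (u : W -> R) : smooth u -> smoothC (fun x => (u x)%:C%C).
Proof. by move=> su; split=> //; exact: smooth_cst. Qed.

Lemma complex_ReM (a b : R[i]) : complex.Re (a * b) =
  complex.Re a * complex.Re b - complex.Im a * complex.Im b.
Proof. by case: a b => [a1 a2] [b1 b2]. Qed.

Lemma complex_ImM (a b : R[i]) : complex.Im (a * b) =
  complex.Re a * complex.Im b + complex.Im a * complex.Re b.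
Proof. by case: a b => [a1 a2] [b1 b2]. Qed.

Lemma complex_ReD (a b : R[i]) : complex.Re (a + b) = complex.Re a + complex.Re b.
Proof. by case: a b => [a1 a2] [b1 b2]. Qed.

Lemma complex_ImD (a b : R[i]) : complex.Im (a + b) = complex.Im a + complex.Im b.
Proof. by case: a b => [a1 a2] [b1 b2]. Qed.

Lemma smoothCM f g : smoothC f -> smoothC g -> smoothC (fun x => f x * g x).
Proof.
move=> [f1 f2] [g1 g2]; split.
  by under eq_fun do rewrite complex_ReM; apply: smoothB; exact: smoothM.
by under eq_fun do rewrite complex_ImM; apply: smoothD; exact: smoothM.
Qed.

Lemma fsupport_sub f (A : set W) : closed A -> (forall x, ~ A x -> f x = 0) ->
  fsupport f `<=` A.
Proof.
move=> /closure_id AE fA; rewrite AE; apply: closureS => x /= /eqP fx.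
by apply: contrapT => /fA.
Qed.

Lemma fsupport_closed f : closed (fsupport f).
Proof. exact: closed_closure. Qed.

Lemma fsupport_eq0 f x : ~ fsupport f x -> f x = 0.
Proof. by move=> H; apply/eqP/negP => fx; apply: H; apply: subset_closure; exact/negP. Qed.

Lemma test_fun_mul (O : set W) f g : test_fun O f -> smoothC g ->
  test_fun O (fun x => f x * g x).
Proof.
move=> [/smooth_onP sf cf fO] sg.
have sub : fsupport (fun x => f x * g x) `<=` fsupport f.
  by apply: fsupport_sub => [|x /fsupport_eq0 ->]; [exact: fsupport_closed|rewrite mul0r].
split; first by apply/smooth_onP; exact: smoothCM.
  exact: subclosed_compact (@fsupport_closed _) cf sub.
exact: subset_trans sub fO.
Qed.

End complex_valued.

Section localisation.
Context {R : realType} {n : nat}.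
Local Notation V := 'rV[R]_n.
Variables (U : set V) (mu : (V -> R[i]) -> R[i]).
Hypothesis mulin : forall (c : R[i]) (f g : V -> R[i]), test_fun U f -> test_fun U g ->
     mu (fun x => c * f x + g x) = c * mu f + mu g.

Lemma test_fun0 : test_fun U (fun=> 0).
Proof.
have sub : fsupport (fun=> 0 : R[i]) `<=` (set0 : set V).
  by apply: fsupport_sub => //; exact: closed0.
split; first by apply/smooth_onP; split; exact: smooth_cst.
  by move: sub; rewrite subset0 => ->; exact: compact0.
by move=> x /sub.
Qed.

Lemma dist0 : mu (fun=> 0) = 0.
Proof.
have := mulin 1 test_fun0 test_fun0.
under eq_fun do rewrite mulr0 addr0.
by rewrite mul1r => /eqP; rewrite -subr_eq subrr eq_sym => /eqP.
Qed.

Lemma distD f g : test_fun U f -> test_fun U g -> mu (fun x => f x + g x) = mu f + mu g.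
Proof.
by move=> tf tg; have := mulin 1 tf tg; under eq_fun do rewrite mul1r; rewrite mul1r.
Qed.

(** Plays the part of a partition of unity: splitting [f = f b + f (1 - b)] for each bump [b] in
    turn leaves [f] times the product of the [1 - b], which is zero as soon as the plateaus cover
    the support of [f]. *)
Lemma bumps_vanish (s : seq V) (r : V -> R) f :
  (forall x g, x \in s -> test_fun U g -> mu (fun y => g y * (bump x (r x) y)%:C%C) = 0) ->
  test_fun U f -> (forall y, f y * (\prod_(x <- s) (1 - bump x (r x) y))%:C%C = 0) ->
  mu f = 0.
Proof.
elim: s f => [|x s IH] f Hs tf f0.
  rewrite (_ : f = fun=> 0) ?dist0//; apply/funext => y.
  by have := f0 y; rewrite big_nil mulr1.
have sb := smoothC_real (smooth_bump x (r x)).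
have sb' : smoothC (fun y => (1 - bump x (r x) y)%:C%C).
  by apply: smoothC_real; apply: smoothB; [exact: smooth_cst|exact: smooth_bump].
rewrite (_ : f = fun y => f y * (bump x (r x) y)%:C%C + f y * (1 - bump x (r x) y)%:C%C); last first.
  by apply/funext => y; rewrite -mulrDr -rmorphD/= addrC subrK mulr1.
rewrite distD; [|exact: test_fun_mul..].
rewrite Hs ?mem_head// add0r; apply: IH; first by move=> z g zs; apply: Hs; rewrite inE zs orbT.
  exact: test_fun_mul.
by move=> y; have := f0 y; rewrite big_cons rmorphM/= mulrA.
Qed.

(** Off [dsupport] the definition gives vanishing only near each point; finitely many bumps, each
    supported in one such neighbourhood, make it global on the compact support of [f]. *)
Lemma dist_eq0 f : test_fun U f -> (forall x, fsupport f x -> ~ dsupport U mu x) -> mu f = 0.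
Proof.
move=> tf fD; have [_ cf fU] := tf.
have /choice[r Hr] : forall x, exists r : R, fsupport f x -> 0 < r /\
    forall g, test_fun U g -> mu (fun y => g y * (bump x r y)%:C%C) = 0.
  move=> x; have [fx|nfx] := pselect (fsupport f x); last by exists 0.
  have [B [oB BU Bx vB]] : exists O : set V, [/\ open O, O `<=` U, O x & vanishes_on O mu].
    by apply: contrapT => H; apply: (fD x fx); split=> //; exact: fU.
  have [r r0 rB] := cball_nbhs oB Bx.
  exists (r / 2) => _; split=> [|g tg]; first by rewrite divr_gt0.
  have [sg cg gU] := test_fun_mul tg (smoothC_real (smooth_bump x (r / 2))).
  apply: vB; split=> //; apply: subset_trans rB.
  apply: fsupport_sub => [|y /= yx]; first exact: cball_closed.
  rewrite bump_eq0 ?mulr0 ?divr_gt0//.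
  by move/negP: yx; rewrite -ltNge => /ltW; lra.
have [s [sf fs]] := compact_finite_balls (r := r) cf (fun x fx => (Hr x fx).1).
apply: (bumps_vanish (s := s) (r := r)) => // [x g /sf /Hr[_]|y]; first exact.
have [fy|/fsupport_eq0 ->] := pselect (fsupport f y); last by rewrite mul0r.
have [x xs yx] := fs y fy.
rewrite (_ : \prod_(x0 <- s) _ = 0) ?mulr0//.
apply/eqP; rewrite prodf_seq_eq0; apply/hasP; exists x => //=.
by rewrite bump_eq1 ?subrr// ?ltW//; have [] := Hr x (sf x xs).
Qed.

(** This gives [pairing] its meaning: the [xget] there then returns a genuine cutoff and not its
    default value 0. The witness is 1 minus a product of factors [1 - b], so it equals 1 wherever
    some bump [b] does. *)
Lemma cutoff_exists : open U -> compact (dsupport U mu) -> exists chi, cutoff U mu chi.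
Proof.
move=> oU cD; have DU : dsupport U mu `<=` U by move=> x [].
have /choice[r Hr] : forall x, exists r : R, dsupport U mu x ->
    0 < r /\ cball x (2 * r) `<=` U.
  move=> x.
  have [Dx|nDx] := pselect (dsupport U mu x); last by exists 0.
  have [r r0 rU] := cball_nbhs oU (DU x Dx).
  by exists (r / 2) => _; split; [rewrite divr_gt0|rewrite mulrC divfK].
have [s [sD Ds]] := compact_finite_balls (r := r) cD (fun x Dx => (Hr x Dx).1).
pose P y := \prod_(x <- s) (1 - bump x (r x) y).
have sP : smooth (fun y => 1 - P y).
  apply: smoothB; first exact: smooth_cst.
  by apply: smooth_prod => x; apply: smoothB; [exact: smooth_cst|exact: smooth_bump].
pose A := \bigcup_(x in [set` s]) cball x (2 * r x).
have [cA AU] : compact A /\ A `<=` U.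
  split; last by move=> y [x /= xs yx]; exact: (Hr x (sD x xs)).2.
  by rewrite /A bigcup_seq; apply: bigsetU_compact => x _; exact: cball_compact.
have supA : fsupport (fun y => (1 - P y)%:C%C) `<=` A.
  apply: fsupport_sub; first exact: compact_closed (@norm_hausdorff _ _) cA.
  move=> y nAy; rewrite /P big_seq big1 ?subrr// => x xs.
  rewrite bump_eq0 ?subr0//; first exact: (Hr x (sD x xs)).1.
  by rewrite leNgt; apply/negP => /ltW yx; apply: nAy; exists x.
exists (fun y => (1 - P y)%:C%C); split.
  split; first by apply/smooth_onP; exact: smoothC_real.
    exact: subclosed_compact (@fsupport_closed _ _ _) cA supA.
  exact: subset_trans supA AU.
move=> y /Ds[x xs yx]; have rx0 := (Hr x (sD x xs)).1.
have : \forall z \near y, `|z - x| < r x.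
  by apply: (@open_nbhs_nbhs _ y [set z | `|z - x| < r x]); split=> //; exact: open_dist_lt.
apply: filterS => z zx; rewrite (_ : P z = 0) ?subr0//.
apply/eqP; rewrite prodf_seq_eq0; apply/hasP; exists x => //=.
by rewrite bump_eq1 ?subrr// ltW.
Qed.

End localisation.

(** * From a distribution and a cutoff to functionals on real smooth functions *)

Section functional_of_distribution.
Context {R : realType} {n : nat}.
Local Notation V := 'rV[R]_n.

Lemma iter_deriv_rcons (vs : seq V) v (f : V -> R) :
  iter_deriv (rcons vs v) f = iter_deriv vs ('D_v f).
Proof. by rewrite /iter_deriv foldr_rcons. Qed.

Lemma iter_derivD (vs : seq V) (f g : V -> R) : smooth f -> smooth g ->
  iter_deriv vs (fun y => f y + g y) = fun y => iter_deriv vs f y + iter_deriv vs g y.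
Proof.
elim/last_ind: vs f g => [//|vs v IH] f g sf sg.
rewrite !iter_deriv_rcons -IH; [|exact: smooth_derive..].
congr iter_deriv; apply/funext => y.
exact: (derive_val (is_derive := is_deriveD (smooth_is_derive y v sf) (smooth_is_derive y v sg))).
Qed.

Lemma derivs_leS N K M (u : V -> R) : derivs_le N.+1 K M u -> derivs_le N K M u.
Proof.
elim: N u => [|N IH] u [u0 uD]; split=> // i; exact: IH (uD i).
Qed.

Lemma continuous_bounded_compact (K : set V) (f : V -> R) : compact K -> continuous f ->
  exists2 C, 0 <= C & forall y, K y -> `|f y| <= C.
Proof.
move=> cK cf; have [K0|/set0P K0] := eqVneq K set0.
  by exists 0 => // y; rewrite K0.
have [|c _ fc] := compact_EVT_max (f := fun y => `|f y|) K0 cK.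
  apply: continuous_subspaceT => t.
  by apply: (@continuous_comp _ _ _ f (@Num.norm R R)); [exact: cf|exact: norm_continuous].
by exists `|f c| => // y Ky; apply: fc; rewrite inE.
Qed.

Lemma derive_eq0_closed (K : set V) (f : V -> R) v : closed K ->
  (forall y, ~ K y -> f y = 0) -> forall y, ~ K y -> 'D_v f y = 0.
Proof.
move=> clK f0 y nKy; have : \forall z \near y, f z = 0.
  apply: filterS (fun z => f0 z) _.
  by apply: open_nbhs_nbhs; split=> //; exact: closed_openC.
by move=> /(@near_eq_derive _ _ _ f (cst 0) y v) ->; rewrite derive_cst.
Qed.

(** Passes from bounds on [u] over [K] to bounds on [chi * u] over the whole space, as [CN_bounded]
    demands. The list is peeled from its last entry, the derivative applied first; the product rule
    then leaves two products of lower order. The induction is general in [chi] because ['D_i chi]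
    also vanishes off [K]. *)
Lemma leibniz_bound (K : set V) (chi : V -> R) N : compact K -> smooth chi ->
  (forall y, ~ K y -> chi y = 0) ->
  exists2 C, 0 <= C & forall u M, smooth u -> 0 <= M -> derivs_le N K M u ->
    forall (s : seq 'I_n) x, (size s <= N)%N ->
      `|iter_deriv (map basis_dir s) (fun y => chi y * u y) x| <= C * M.
Proof.
move=> cK; have clK : closed K := compact_closed (@norm_hausdorff _ _) cK.
elim: N chi => [|N IH] chi schi chi0;
    have [C0 C00 chiC] := continuous_bounded_compact cK (smooth_continuous schi).
  have base (u : V -> R) (M : R) (x : V) : 0 <= M -> (forall y, K y -> `|u y| <= M) ->
      `|chi x * u x| <= C0 * M.
    move=> M0 uM; have [Kx|/chi0 ->] := pselect (K x); last by rewrite mul0r normr0 mulr_ge0.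
    by rewrite normrM ler_pM// ?chiC// uM.
  exists C0 => // u M su M0 [uM _] s x; rewrite leqn0 size_eq0 => /eqP -> /=; exact: base.
have base (u : V -> R) (M : R) (x : V) : 0 <= M -> (forall y, K y -> `|u y| <= M) ->
    `|chi x * u x| <= C0 * M.
  move=> M0 uM; have [Kx|/chi0 ->] := pselect (K x); last by rewrite mul0r normr0 mulr_ge0.
  by rewrite normrM ler_pM// ?chiC// uM.
have [C1 C10 HC1] := IH chi schi chi0.
have /choice[Ci HCi] : forall i : 'I_n, exists C, 0 <= C /\
    forall u M, smooth u -> 0 <= M -> derivs_le N K M u ->
    forall (s : seq 'I_n) x, (size s <= N)%N ->
      `|iter_deriv (map basis_dir s) (fun y => 'D_(basis_dir i) chi y * u y) x| <= C * M.
  move=> i; have [||C C0' HC] := IH ('D_(basis_dir i) chi).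
  - exact: smooth_derive.
  - exact: derive_eq0_closed.
  - by exists C.
have S0 : 0 <= \sum_i Ci i by apply: sumr_ge0 => i _; have [] := HCi i.
exists (C0 + C1 + \sum_i Ci i); first by rewrite !addr_ge0.
move=> u M su M0 uM s x; case/lastP: s => [_|s i].
  case: uM => uM _; apply: (le_trans (base u M x M0 uM)).
  by rewrite ler_wpM2r// -addrA lerDl addr_ge0.
rewrite size_rcons ltnS => sN; rewrite map_rcons iter_deriv_rcons.
have -> : 'D_(basis_dir i) (fun y => chi y * u y) =
    fun y => 'D_(basis_dir i) chi y * u y + chi y * 'D_(basis_dir i) u y.
  apply/funext => y.
  have := derive_val (is_derive := is_deriveM (smooth_is_derive y (basis_dir i) schi)
    (smooth_is_derive y (basis_dir i) su)).
  by rewrite /GRing.scale/= => ->; rewrite addrC mulrC.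
have sDu := smooth_derive (basis_dir i) su.
have sDchi := smooth_derive (basis_dir i) schi.
rewrite iter_derivD; [|exact: smoothM..].
apply: (le_trans (ler_normD _ _)).
have h1 := (HCi i).2 u M su M0 (derivs_leS uM) s x sN.
have h2 := HC1 _ M sDu M0 (uM.2 i) s x sN.
apply: (le_trans (lerD h1 h2)); rewrite -mulrDl ler_wpM2r//.
have hi : Ci i <= \sum_j Ci j.
  by rewrite (bigD1 i)//= lerDl sumr_ge0// => j _; have [] := HCi j.
lra.
Qed.

Variables (U : set V) (mu : (V -> R[i]) -> R[i]) (chi : V -> R[i]).
Hypotheses (hmu : schwartz_distribution U mu) (tchi : test_fun U chi).

Lemma Re_normc (z : R[i]) : `|complex.Re z| <= Normc.normc z.
Proof.
case: z => x y /=; rewrite -sqrtr_sqr ler_sqrt ?addr_ge0 ?sqr_ge0//.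
by rewrite lerDl sqr_ge0.
Qed.

Lemma Im_normc (z : R[i]) : `|complex.Im z| <= Normc.normc z.
Proof.
case: z => x y /=; rewrite -sqrtr_sqr ler_sqrt ?addr_ge0 ?sqr_ge0//.
by rewrite lerDr sqr_ge0.
Qed.

Lemma normc_le (x y : R) : Normc.normc (x +i* y)%C <= `|x| + `|y|.
Proof.
rewrite /= -[leRHS]ger0_norm ?addr_ge0// -sqrtr_sqr ler_sqrt ?sqr_ge0//.
rewrite sqrrD !real_normK ?num_real// mulr2n.
have : 0 <= `|x| * `|y| by rewrite mulr_ge0.
lra.
Qed.

(** [part] stands for the real or the imaginary part. Multiplication by [chi] makes [mu] act on
    every smooth real function, and the estimate of [mu] on the compact support of [chi] becomes one
    by derivatives on that set. *)
Lemma dist_functional (part : R[i] -> R) :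
  (forall z w, part (z + w) = part z + part w) ->
  (forall (c : R) z, part (c%:C%C * z) = c * part z) ->
  (forall z, `|part z| <= Normc.normc z) ->
  smooth_functional (fsupport chi) (fun u => part (mu (fun y => chi y * (u y)%:C%C))).
Proof.
move=> partD partZ part_le; have [mulin mubnd] := hmu.
have [/smooth_onP[schi1 schi2] cK KU] := tchi.
have tu u : smooth u -> test_fun U (fun y => chi y * (u y)%:C%C).
  by move=> su; apply: test_fun_mul => //; exact: smoothC_real.
split=> [c u v su sv|].
  rewrite (_ : (fun y => chi y * _) = fun y => c%:C%C * (chi y * (u y)%:C%C) + chi y * (v y)%:C%C).
    by rewrite mulin ?partD ?partZ//; exact: tu.
  by apply/funext => y; rewrite rmorphD rmorphM/= mulrDr mulrCA.
have [N [C HC]] := mubnd _ cK KU.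
have [C1 C10 H1] := @leibniz_bound _ (fun y => complex.Re (chi y)) N cK schi1
  (fun y Ky => congr1 (@complex.Re R) (fsupport_eq0 Ky)).
have [C2 C20 H2] := @leibniz_bound _ (fun y => complex.Im (chi y)) N cK schi2
  (fun y Ky => congr1 (@complex.Im R) (fsupport_eq0 Ky)).
(* The constant in [schwartz_distribution] has no prescribed sign, hence the absolute value. *)
exists N, (`|C| * (C1 + C2)); split; first by rewrite mulr_ge0// addr_ge0.
move=> u M su M0 uM; apply: (le_trans (part_le _)).
apply: (@le_trans _ _ (C * ((C1 + C2) * M))); last first.
  by rewrite -mulrA ler_wpM2r ?ler_norm// mulr_ge0// addr_ge0.
apply: HC; first exact: tu.
  by apply: fsupport_sub => [|y /fsupport_eq0 ->]; [exact: fsupport_closed|rewrite mul0r].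
move=> s x sN; rewrite /iter_derivC; apply: (le_trans (normc_le _ _)).
rewrite mulrDl; apply: lerD.
  under [X in iter_deriv _ X]eq_fun do rewrite complex_ReM/= mulr0 subr0.
  exact: H1.
under [X in iter_deriv _ X]eq_fun do rewrite complex_ImM/= mulr0 add0r.
exact: H2.
Qed.

Lemma dist_near_eq0 (u : V -> R) : smooth u ->
  (forall x, dsupport U mu x -> \forall y \near x, u y = 0) ->
  mu (fun y => chi y * (u y)%:C%C) = 0.
Proof.
move=> su uD; have [mulin _] := hmu; apply: (dist_eq0 mulin).
  by apply: test_fun_mul => //; exact: smoothC_real.
move=> x + Dx => /(_ _ (uD x Dx))[y [/= /eqP nz uy]].
by apply: nz; rewrite uy mulr0.
Qed.

End functional_of_distribution.

(** * Moments of the divergent beam transform *)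

Lemma sint_sum {R : realType} (a b : R) (T : Type) (r : seq T) (f : T -> R -> R) :
  (forall i, continuous (f i)) ->
  sint a b (fun x => \sum_(i <- r) f i x) = \sum_(i <- r) sint a b (f i) /\
  continuous (fun x : R => \sum_(i <- r) f i x).
Proof.
move=> cf; elim: r => [|i r [IH cIH]].
  under eq_fun do rewrite big_nil.
  by rewrite big_nil sint0; split=> //; exact: cst_continuous.
under eq_fun do rewrite big_cons.
rewrite sintD// IH big_cons; split=> // x.
by apply: cvgD; [exact: cf|exact: cIH].
Qed.

Section clamp.
Context {R : realType}.

Definition clamp (u v x : R) := Num.max u (Num.min x v).

Lemma clampK u v x : u <= x <= v -> clamp u v x = x.
Proof. by move=> /andP[ux xv]; rewrite /clamp (min_idPl xv) (max_idPr ux). Qed.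

Lemma clamp_in u v x : u <= v -> u <= clamp u v x <= v.
Proof. by move=> uv; rewrite /clamp le_max lexx/= ge_max uv ge_min lexx orbT. Qed.

Lemma continuous_clamp u v : continuous (clamp u v).
Proof.
move=> x; apply: (@continuous_max R R (fun=> u) (fun x => Num.min x v)); first exact: cvg_cst.
by apply: (@continuous_min R R id (fun=> v)); [exact: cvg_id|exact: cvg_cst].
Qed.

Definition inv_from (t1 t : R) := (Num.max t1 t)^-1.

Lemma continuous_max_from t1 : continuous (fun t : R => Num.max t1 t).
Proof.
by move=> x; apply: (@continuous_max R R (fun=> t1) id); [exact: cvg_cst|exact: cvg_id].
Qed.

Lemma continuous_inv_from t1 : 0 < t1 -> continuous (inv_from t1).
Proof.
move=> t10 x; apply: (@continuousV R R (fun t => Num.max t1 t)).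
  by rewrite gt_eqF// lt_max t10.
exact: continuous_max_from.
Qed.

End clamp.

Section beam_moments.
Context {R : realType} {n : nat}.
Local Notation V := 'rV[R]_n.
Variables (a : R -> V) (j1 j2 t1 t2 : R).
Hypotheses (j12 : j1 < j2) (t10 : 0 < t1) (t12 : t1 <= t2).
Hypothesis (aC1 : forall s, j1 <= s <= j2 -> derivable a s 1 /\ {for s, continuous (derive1 a)}).

Definition aclamp s := a (clamp j1 j2 s).
Definition dclamp j s := (derive1 a (clamp j1 j2 s)) 0 j.

(* On [[j1, j2] * [t1, t2]] this is [t^(k - n) g((y - a s) / t)]; the clamped
   variables make it continuous in [(s, t)] on the whole plane. *)
Definition fibre k (g : V -> R) (z : R * R) (y : V) : R :=
  (Num.max t1 z.2 ^+ k * inv_from t1 z.2 ^+ n) * g (inv_from t1 z.2 *: (y - aclamp z.1)).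

Definition beam_moment k g (s : R) (y : V) : R := sint t1 t2 (fun t => fibre k g (s, t) y).

Lemma continuous_aclamp : continuous aclamp.
Proof.
move=> s; apply: (@continuous_comp _ _ _ (clamp j1 j2) a); first exact: continuous_clamp.
apply: differentiable_continuous; apply/derivable1_diffP.
by apply: (aC1 _).1; apply: clamp_in; exact: ltW.
Qed.

Lemma continuous_dclamp j : continuous (dclamp j).
Proof.
move=> s; apply: (@continuous_comp _ _ _ (fun s => derive1 a (clamp j1 j2 s)) (fun v : V => v 0 j)).
  apply: (@continuous_comp _ _ _ (clamp j1 j2) (derive1 a)); first exact: continuous_clamp.
  by apply: (aC1 _).2; apply: clamp_in; exact: ltW.
exact: coord_continuous.
Qed.

Lemma smooth_family_fibre k g : smooth g -> smooth_family (fibre k g).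
Proof.
move=> sg m; apply: (@Ck_family_affine R _ V V m g id
  (fun z : R * R => Num.max t1 z.2 ^+ k * inv_from t1 z.2 ^+ n)
  (fun z : R * R => inv_from t1 z.2) (fun z : R * R => aclamp z.1)) => //.
- by move=> x; exact: cvg_id.
- apply: (continuous_snd_comp (f := fun t => Num.max t1 t ^+ k * inv_from t1 t ^+ n)) => t.
  apply: cvgM.
    apply: (@continuous_comp _ _ _ (fun t => Num.max t1 t) (fun t : R => t ^+ k)).
      exact: continuous_max_from.
    exact: exprn_continuous.
  apply: (@continuous_comp _ _ _ (inv_from t1) (fun t : R => t ^+ n)).
    exact: continuous_inv_from.
  exact: exprn_continuous.
- exact/continuous_snd_comp/continuous_inv_from.
- exact/continuous_fst_comp/continuous_aclamp.
Qed.

Lemma smooth_family_beam_moment k g : smooth g -> smooth_family (beam_moment k g).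
Proof.
move=> sg; apply: (@smooth_family_sint R R V t1 t2 (fibre k g)) => //.
exact: smooth_family_fibre.
Qed.

Lemma continuous_fibre k g y : smooth g -> continuous (fun z => fibre k g z y).
Proof.
move=> sg; exact: (continuous_slice2 (F := fibre k g)
  (Ck_family_continuous (smooth_family_fibre k sg 0%N))).
Qed.

Lemma continuous_fibre_snd k g s y : smooth g -> continuous (fun t => fibre k g (s, t) y).
Proof.
move=> sg; apply: (@continuous_slice R R R (fun s t => fibre k g (s, t) y)).
rewrite (_ : (fun z => _) = fun z => fibre k g z y); first exact: continuous_fibre.
by apply/funext => -[].
Qed.

Lemma is_derive_fibre k g (s t : R) y : smooth g -> j1 < s < j2 ->
  is_derive s (1 : R) (fun s : R => fibre k.+1 g (s, t) y)
    (\sum_(j < n) - dclamp j s * fibre k ('D_(basis_dir j) g) (s, t) y).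
Proof.
move=> sg /andP[j1s sj2]; have sj : j1 <= s <= j2 by rewrite !ltW.
have [da _] := aC1 sj.
pose c := inv_from t1 t; pose gam (s : R) : V := c *: (y - a s).
have dgam : is_derive s (1 : R) gam (c *: (0 - 'D_1 a s)).
  have da' : is_derive s (1 : R) a ('D_1 a s) by exact: derivableP.
  by apply: is_deriveZ; apply: is_deriveB.
pose K := Num.max t1 t ^+ k.+1 * c ^+ n.
(* Since [s] is interior, the clamp is the identity nearby and the derivative is that of the
   unclamped function. *)
apply: (@near_eq_is_derive R R R (fun s => K * g (gam s)) _ s 1).
  near=> s'; rewrite /fibre/= /aclamp clampK//.
  by apply/andP; split; apply/ltW; near: s'; [exact: lt_nbhsr|exact: lt_nbhsl].
have gamD : derivable gam s 1 by case: dgam.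
have H : is_derive s (1 : R) (fun s : R => K * g (gam s)) _ :=
  is_deriveZ K (is_derive_curve sg gamD).
apply: (is_derive_eq H); rewrite derive_val sub0r.
(* The factor [c = 1/t] from the chain rule cancels one power of [t]: this lowers [k.+1] to [k]. *)
have Kc : K * c = Num.max t1 t ^+ k * c ^+ n.
  have mc : Num.max t1 t * c = 1 by rewrite mulfV// gt_eqF// lt_max t10.
  rewrite /K exprSr (_ : _ * c = Num.max t1 t ^+ k * (Num.max t1 t * c) * c ^+ n); last by ring.
  by rewrite mc mulr1.
rewrite [LHS]/GRing.scale/= mulr_sumr; apply: eq_bigr => j _.
rewrite /fibre /= /dclamp /aclamp clampK// derive1E -/c -Kc !mxE /gam.
by ring.
Unshelve. all: by end_near. Qed.

Lemma is_derive_beam_moment k g (s : R) y : smooth g -> j1 < s < j2 ->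
  is_derive s (1 : R) (fun s : R => beam_moment k.+1 g s y)
    (\sum_(j < n) - dclamp j s * beam_moment k ('D_(basis_dir j) g) s y).
Proof.
move=> sg sj.
pose f' s t := \sum_(j < n) - dclamp j s * fibre k ('D_(basis_dir j) g) (s, t) y.
have cdir j : continuous (fun t => - dclamp j s * fibre k ('D_(basis_dir j) g) (s, t) y).
  move=> t'; apply: cvgM; first exact: cvg_cst.
  by apply: continuous_fibre_snd; exact: smooth_derive.
have [sumE csum] := @sint_sum R t1 t2 _ (index_enum 'I_n)
  (fun j t => - dclamp j s * fibre k ('D_(basis_dir j) g) (s, t) y) cdir.
have <- : sint t1 t2 (f' s) =
    \sum_(j < n) - dclamp j s * beam_moment k ('D_(basis_dir j) g) s y.
  rewrite sumE; apply: eq_bigr => j _; rewrite sintZ//.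
  by apply: continuous_fibre_snd; exact: smooth_derive.
apply: (@sint_is_derive R t1 t2 (fun s t => fibre k.+1 g (s, t) y) f') => //.
- near=> s' => t; apply: is_derive_fibre => //; apply/andP; split; near: s'.
    by apply: lt_nbhsr; case/andP: sj.
  by apply: lt_nbhsl; case/andP: sj.
- by move=> s'; exact: continuous_fibre_snd.
- move=> t.
  have cF : Ck_family 0 (fun (z : R * R) (y : V) =>
      \sum_(j < n) - dclamp j z.1 * fibre k ('D_(basis_dir j) g) z y).
    apply: Ck_family_sum => j; apply: Ck_familyM.
      apply: (@Ck_family_cst R _ V 0%N (fun z : R * R => - dclamp j z.1)).
      apply: (continuous_fst_comp (f := fun s => - dclamp j s)) => s'.
      by apply: cvgN; exact: continuous_dclamp.
    by apply: smooth_family_fibre; exact: smooth_derive.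
  have := continuous_slice2 (q := y) (Ck_family_continuous cF).
  rewrite (_ : (fun z : R * R => _) = fun z : R * R => f' z.1 z.2); first by apply.
  by apply/funext => -[].
Unshelve. all: by end_near. Qed.

Section functional.
Variables (K : set V) (Lam : (V -> R) -> R).
Hypotheses (cK : compact K) (LamP : smooth_functional K Lam).

Lemma beam_moment_increment k g s s' : smooth g -> j1 <= s -> s < s' -> s' <= j2 ->
  Lam (beam_moment k.+1 g s') - Lam (beam_moment k.+1 g s) =
  sint s s' (fun r => \sum_(j < n) - dclamp j r * Lam (beam_moment k ('D_(basis_dir j) g) r)).
Proof.
move=> sg j1s ss' s'j2.
have sG m h : smooth h -> smooth_family (beam_moment m h) by exact: smooth_family_beam_moment.
have sD j : smooth ('D_(basis_dir j) g) by exact: smooth_derive.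
pose Psi r y := \sum_(j < n) - dclamp j r * beam_moment k ('D_(basis_dir j) g) r y.
have sPsi : smooth_family Psi.
  move=> m; apply: Ck_family_sum => j; apply: Ck_familyM; last exact: sG.
  apply: (@Ck_family_cst R R V m (fun r => - dclamp j r)) => r.
  by apply: cvgN; exact: continuous_dclamp.
have slice (Phi : R -> V -> R) y : smooth_family Phi -> continuous (Phi ^~ y).
  by move=> sPhi; exact: (continuous_slice2 (q := y) (Ck_family_continuous (sPhi 0%N))).
rewrite -(functionalB LamP); [|exact: smooth_family_smooth (sG _ _ sg)..].
have -> : (fun y => beam_moment k.+1 g s' y - beam_moment k.+1 g s y) =
    fun y => sint s s' (fun r => Psi r y).
  apply/funext => y; symmetry.
  apply: (@sint_FTC R s s' _ (fun r => beam_moment k.+1 g r y) ss').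
  - exact: (slice Psi).
  - exact: (slice (beam_moment k.+1 g) y (sG _ _ sg)).
  - by move=> r /andP[sr rs']; apply: is_derive_beam_moment => //; lra.
rewrite (functional_sint cK LamP)//; last exact: ltW.
apply: eq_sint => r _; rewrite (functional_sum LamP) => [|j].
  by apply: eq_bigr => j _; rewrite (functionalZ LamP)//; exact: smooth_family_smooth (sG _ _ (sD j)).
by apply: smoothM; [exact: smooth_cst|exact: smooth_family_smooth (sG _ _ (sD j))].
Qed.

(** Exhibits the value as the [k]-th moment in [t] of a function that does not depend on [k], the
    form to which [moments_eq0] applies. *)
Lemma functional_beam_moment k g s : smooth g ->
  Lam (beam_moment k g s) =
  sint t1 t2 (fun t => Num.max t1 t ^+ k *
    (inv_from t1 t ^+ n * Lam (fun y => g (inv_from t1 t *: (y - aclamp s))))).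
Proof.
move=> sg; rewrite /beam_moment.
have sF : smooth_family (fun t => fibre k g (s, t)).
  move=> m; apply: (Ck_family_reparam (theta := fun t => (s, t)) _ (smooth_family_fibre k sg m)) => t.
  by apply: (@cvg_pair _ _ _ (nbhs t) (nbhs s) (nbhs t)); [exact: cvg_cst|exact: cvg_id].
rewrite (functional_sint cK LamP)//; apply: eq_sint => t _.
rewrite /fibre /= (functionalZ LamP) ?mulrA//.
exact: smooth_dilate.
Qed.

End functional.
End beam_moments.

(** Trades the integrals over [I] and over the half-line in the formal adjoint for integrals over
    segments. *)
Lemma eq_Rintegral_supp {R : realType} (A B : set R) (f g : R -> R) :
  (forall t, A t -> B t -> f t = g t) -> (forall t, A t -> ~ B t -> f t = 0) ->
  (forall t, B t -> ~ A t -> g t = 0) ->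
  \int[lebesgue_measure]_(t in A) f t = \int[lebesgue_measure]_(t in B) g t.
Proof.
move=> AB AnB BnA; rewrite Rintegral_mkcond [RHS]Rintegral_mkcond.
congr (Rintegral _ _ _); apply/funext => t; rewrite !patchE.
have [At|nAt] := pselect (A t); have [Bt|nBt] := pselect (B t);
  rewrite ?(mem_set At) ?(mem_set Bt) ?(memNset nAt) ?(memNset nBt)//; first exact: AB.
- exact: AnB.
- by rewrite BnA.
Qed.

Lemma compact_pos_bounds {R : realType} {T : topologicalType} (A : set T) (f : T -> R) :
  compact A -> continuous f -> (forall z, A z -> 0 < f z) ->
  exists d B, 0 < d /\ forall z, A z -> d <= f z <= B.
Proof.
move=> cA cf fpos; have [A0|/set0P A0] := eqVneq A set0.
  by exists 1, 1; split=> // z; rewrite A0.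
have cAf : {within A, continuous f} by exact: continuous_subspaceT.
have [z1 /set_mem Az1 m1] := compact_EVT_min A0 cA cAf.
have [z2 _ m2] := compact_EVT_max A0 cA cAf.
exists (f z1), (f z2); split; first exact: fpos.
by move=> z Az; rewrite m1 ?m2 ?inE.
Qed.

(** * Uniqueness for a real functional over a compact piece of the curve *)

Section uniqueness.
Context {R : realType} {n : nat}.
Local Notation V := 'rV[R]_n.
Variables (a : R -> V) (j1 j2 : R).
Hypotheses (j12 : j1 < j2)
  (aC1 : forall s, j1 <= s <= j2 -> derivable a s 1 /\ {for s, continuous (derive1 a)}).
Variables (K : set V) (Lam : (V -> R) -> R).
Hypotheses (cK : compact K) (LamP : smooth_functional K Lam)
  (Ka : forall y s, K y -> j1 <= s <= j2 -> y != a s).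
Variables (F : set V) (c1 c2 : R).
Hypotheses (c10 : 0 < c1) (Fc : forall x, F x -> c1 <= `|x| <= c2) (clF : closed F).

(** If [(y - a s) / t] lies in [F], then [t] is the quotient of [|y - a s|] by a norm between [c1]
    and [c2]. The numerator has positive bounds [d] and [B], because [K] and [[j1, j2]] are compact
    and [K] avoids the curve. *)
Lemma beam_time_range : exists t1 t2, [/\ 0 < t1, t1 < 1, 1 < t2 &
  forall y s t, K y -> j1 <= s <= j2 -> 0 < t -> F (t^-1 *: (y - a s)) -> t1 <= t <= t2].
Proof.
have [|z [Kz zj]|d [B [d0 dB]]] := @compact_pos_bounds R _ (K `*` `[j1, j2])
    (fun z : V * R => `|z.1 - aclamp a j1 j2 z.2|) (compact_setX cK (@segment_compact R j1 j2)).
- move=> z; apply: (@continuous_comp _ _ _ (fun z : V * R => z.1 - aclamp a j1 j2 z.2) (@Num.norm R V)).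
    apply: (@cvgB _ _ _ (nbhs z)); first exact: cvg_fst.
    exact: (continuous_snd_comp (continuous_aclamp j12 aC1)).
  exact: norm_continuous.
- rewrite normr_gt0 subr_eq0; apply: Ka => //.
  by apply: clamp_in; exact: ltW.
have C0 : 0 < `|c2| + 1 by rewrite ltr_wpDl.
(* The bounds [1 / 2] and [2] put 1 strictly inside the range, since the moment argument is
   evaluated at [t = 1]; [|c2| + 1] is a positive upper bound for [c2]. *)
exists (Num.min (1 / 2) (d / (`|c2| + 1))), (Num.max 2 (B / c1)); split.
- by rewrite lt_min !divr_gt0.
- by rewrite gt_min; apply/orP; left; lra.
- by rewrite lt_max; apply/orP; left; lra.
move=> y s t Ky sj t0 /Fc; rewrite normrZ gtr0_norm ?invr_gt0// => /andP[h1 h2].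
have /andP[/= hd hB] := dB (y, s) (conj Ky sj).
rewrite /aclamp clampK// in hd hB.
rewrite ler_pdivlMl// in h1; rewrite ler_pdivrMl// in h2.
apply/andP; split; rewrite ?ge_min ?le_max; apply/orP; right.
  rewrite ler_pdivrMr//; apply: (le_trans hd); apply: (le_trans h2).
  by rewrite ler_wpM2l ?(ltW t0)//; apply: (le_trans (ler_norm _)); rewrite lerDl.
by rewrite ler_pdivlMr//; apply: le_trans hB.
Qed.

Definition vanishes_off (g : V -> R) := forall x, ~ F x -> g x = 0.

Variable s1 : R.
(** [Hmiss]: the rays from [a s1] with direction in [F] avoid the support of [Lam]. [Hbeam]: the
    transform vanishes on products of a bump in [s] and [g]. It is phrased through a smooth [u] that
    agrees with the adjoint on [K], since it is for [y] in [K] that the adjoint is an integral over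
    a fixed segment in [t]. *)
Hypotheses (s1j : j1 < s1 < j2)
  (Hmiss : forall u, smooth u ->
    (forall y, (forall t, 0 < t -> ~ F (t^-1 *: (y - a s1))) -> u y = 0) -> Lam u = 0)
  (Hbeam : forall g s0 r, smooth g -> vanishes_off g -> 0 < r ->
    j1 < s0 - 2 * r -> s0 + 2 * r < j2 -> forall u, smooth u ->
    (forall y, K y -> u y = sint (s0 - 2 * r) (s0 + 2 * r) (fun s =>
      \int[lebesgue_measure]_(t in `]0, +oo[)
        (t^-1 ^+ n * (bump1 (r^-1 * (s - s0)) * g (t^-1 *: (y - a s)))))) ->
    Lam u = 0).

Lemma vanishes_off_derive g v : vanishes_off g -> vanishes_off ('D_v g).
Proof. by move=> g0; exact: derive_eq0_closed. Qed.

(** The induction is general in [g] and [s]: the increment of order [k.+1] involves order [k] for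
    the partial derivatives of [g], at all intermediate parameters. *)
Lemma functional_beam_moment_eq0 t1 t2 k g s : 0 < t1 -> t1 <= t2 ->
  (forall y s t, K y -> j1 <= s <= j2 -> 0 < t -> F (t^-1 *: (y - a s)) -> t1 <= t <= t2) ->
  smooth g -> vanishes_off g -> j1 < s < j2 -> Lam (beam_moment a j1 j2 t1 t2 k g s) = 0.
Proof.
move=> t10 t12 Ht; elim: k g s => [|k IH] g s sg g0 sj.
  have sG : smooth_family (beam_moment a j1 j2 t1 t2 0 g).
    exact: smooth_family_beam_moment.
  (* Below these thresholds for [r], the segment from [s - 2 * r] to [s + 2 * r] stays inside []j1,
     j2[]. *)
  apply: (@bump_integral_eq0 R (fun s => Lam (beam_moment a j1 j2 t1 t2 0 g s)) s
    (Num.min ((s - j1) / 2) ((j2 - s) / 2))).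
  - exact: (functional_continuous cK LamP sG).
  - by rewrite lt_min !divr_gt0// subr_gt0; case/andP: sj.
  move=> r /andP[r0]; rewrite lt_min => /andP[rj1 rj2].
  pose b r s0 s : R := bump1 (r^-1 * (s - s0)).
  have cb : continuous (b r s).
    move=> x; apply: (@continuous_comp _ _ _ (fun s0 => r^-1 * (s0 - s)) bump1).
      by apply: cvgM; [exact: cvg_cst|apply: cvgB; [exact: cvg_id|exact: cvg_cst]].
    by apply: smooth_continuous; exact: smooth_bump1.
  have sbG : smooth_family (fun x y => b r s x * beam_moment a j1 j2 t1 t2 0 g x y).
    by move=> m; apply: Ck_familyM; [exact: Ck_family_cst|exact: sG].
  have rr : s - 2 * r <= s + 2 * r by lra.
  have <- : Lam (fun y => sint (s - 2 * r) (s + 2 * r)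
      (fun x => b r s x * beam_moment a j1 j2 t1 t2 0 g x y)) =
    sint (s - 2 * r) (s + 2 * r) (fun x => b r s x * Lam (beam_moment a j1 j2 t1 t2 0 g x)).
    rewrite (functional_sint cK LamP rr sbG); apply: eq_sint => x _.
    by rewrite (functionalZ LamP)//; exact: smooth_family_smooth sG.
  apply: (Hbeam (g := g) (s0 := s) (r := r)) => //; [lra|lra|exact: smooth_sint|].
  move=> y Ky; apply: eq_sint => x xr.
  rewrite -sintZ; last exact: continuous_fibre_snd.
  have xj : j1 <= x <= j2 by lra.
  (* For [t] outside [[t1, t2]] the argument of [g] leaves [F], so the integrand over the half-line
     is zero there. *)
  symmetry; apply: eq_Rintegral_supp => t /=; rewrite !in_itv/= ?andbT.
  - move=> t0 /andP[t1t _]; rewrite /fibre/= /inv_from (max_idPr t1t) expr0 mul1r.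
    by rewrite /aclamp clampK// /b mulrCA.
  - move=> t0 nt; rewrite g0 ?mulr0 ?mulr0// => Ft; apply: nt; exact: (Ht y x).
  - by move=> /andP[t1t _] /negP; rewrite -leNgt; lra.
have at_s1 h m : smooth h -> vanishes_off h -> Lam (beam_moment a j1 j2 t1 t2 m h s1) = 0.
  move=> sh h0; apply: Hmiss; first exact: smooth_family_smooth (smooth_family_beam_moment _ _ _ _ _ _).
  move=> y ny; rewrite /beam_moment (_ : (fun t => _) = fun=> 0) ?sint0//.
  apply/funext => t; rewrite /fibre/= h0 ?mulr0//.
  have s1j' : j1 <= s1 <= j2 by case/andP: s1j => ? ?; rewrite !ltW.
  by rewrite /inv_from /aclamp clampK//; apply: ny; rewrite lt_max t10.
have incr x x' : j1 < x -> x < x' -> x' < j2 ->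
    Lam (beam_moment a j1 j2 t1 t2 k.+1 g x') = Lam (beam_moment a j1 j2 t1 t2 k.+1 g x).
  move=> j1x xx' x'j2; apply/eqP; rewrite -subr_eq0; apply/eqP.
  rewrite (beam_moment_increment j12 t10 t12 aC1 cK LamP)//; [|exact: ltW..].
  rewrite (@eq_sint _ _ _ _ (fun=> 0)) ?sint0// => r xr.
  have rj : j1 < r < j2 by case/andP: xr => xr rx'; rewrite (lt_le_trans j1x xr) (le_lt_trans rx' x'j2).
  rewrite big1// => j _; rewrite IH ?mulr0//; first exact: smooth_derive.
  exact: vanishes_off_derive.
have [ss1|s1s|->] := ltgtP s s1; last exact: at_s1.
- by rewrite -(incr s s1) ?at_s1//; [case/andP: sj|case/andP: s1j].
- by rewrite (incr s1 s) ?at_s1//; [case/andP: s1j|case/andP: sj].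
Qed.

Lemma beam_uniqueness g s : smooth g -> vanishes_off g -> j1 < s < j2 ->
  Lam (fun y => g (y - a s)) = 0.
Proof.
move=> sg g0 sj; have [t1 [t2 [t10 t11 t21 Ht]]] := beam_time_range.
have t12 : t1 <= t2 by lra.
pose nu t := inv_from t1 t ^+ n * Lam (fun y => g (inv_from t1 t *: (y - a s))).
have cinv := continuous_inv_from t10.
suff : nu 1 = 0.
  rewrite /nu /inv_from max_r ?(ltW t11)// invr1 expr1n mul1r.
  by under eq_fun do rewrite scale1r.
apply: (@moments_eq0 R t1 t2); [|lra|].
  move=> t; apply: cvgM.
    apply: (@continuous_comp _ _ _ (inv_from t1) (fun t : R => t ^+ n)); first exact: cinv.
    exact: exprn_continuous.
  apply: (functional_continuous cK LamP (Phi := fun t y => g (inv_from t1 t *: (y - a s)))) => m.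
  have cid : continuous (@id V) by move=> x; exact: cvg_id.
  have := @Ck_family_affine R R V V m g id (fun=> 1) (inv_from t1) (fun=> a s)
    cid (fun _ _ _ => erefl) (@cst_continuous _ _ _) cinv (@cst_continuous _ _ _) (sg m).
  by under eq_fun do under eq_fun do rewrite mul1r.
move=> k; rewrite -[RHS](functional_beam_moment_eq0 k t10 t12 Ht sg g0 sj).
rewrite (functional_beam_moment j12 t10 t12 aC1 cK LamP)//.
apply: eq_sint => t /andP[t1t _]; rewrite /nu (max_idPr t1t).
by rewrite /aclamp clampK//; lra.
Qed.

End uniqueness.

(** * Rays and cones *)

Section geometry.
Context {R : realType} {n : nat}.
Local Notation V := 'rV[R]_n.

Lemma open_nonzero : open [set v : V | v != 0].
Proof.
have -> : [set v : V | v != 0] = ~` [set 0].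
  by apply/funext => v; apply/propext; split=> [/eqP //|/= v0]; exact/eqP.
exact/closed_openC/accessible_closed_set1/hausdorff_accessible/norm_hausdorff.
Qed.

(** A ray is not compact, but for directions near [x0], of norm at least [|x0| / 2], its points
    beyond the time [T] are at distance more than [|y0 - p| + 1] from [p], out of reach for [y] near
    [y0]. On [[0, T]] the tube argument applies. *)
Lemma ray_avoid_near (p y0 x0 : V) : x0 != 0 -> (forall t, 0 <= t -> y0 != p + t *: x0) ->
  \forall z \near (y0, x0), forall t, 0 <= t -> z.1 != p + t *: z.2.
Proof.
move=> x00 y0x0; have nx0 : 0 < `|x0| by rewrite normr_gt0.
pose T := (`|y0 - p| + 1) / (`|x0| / 2).
have tube : \forall z \near (y0, x0), forall t, `[0, T]%classic t -> z.1 != p + t *: z.2.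
  have /compact_near_coveringP cT := @segment_compact R 0 T.
  apply: (cT (V * V)%type (nbhs (y0, x0)) (fun z t => z.1 != p + t *: z.2)) => t.
  rewrite /= in_itv/= => /andP[t0 _].
  pose f (w : R * (V * V)) : V := w.2.1 - (p + w.1 *: w.2.2).
  have cfst : continuous (fun w : R * (V * V) => w.2.1).
    by apply: (continuous_snd_comp (f := fst)) => w; exact: cvg_fst.
  have csnd : continuous (fun w : R * (V * V) => w.2.2).
    by apply: (continuous_snd_comp (f := snd)) => w; exact: cvg_snd.
  have cf : {for (t, (y0, x0)), continuous f}.
    apply: (@cvgB _ _ _ (nbhs (t, (y0, x0)))); first exact: cfst.
    apply: cvgD; first exact: cvg_cst.
    by apply: cvgZ; [exact: cvg_fst|exact: csnd].
  have f0 : f (t, (y0, x0)) != 0 by rewrite subr_eq0 y0x0.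
  have := cf [set v | v != 0]; rewrite /f/= => /(_ _)/wrap[].
    by apply: open_nbhs_nbhs; split; [exact: open_nonzero|exact: f0].
  move=> H; have {}H : \forall w \near (t, (y0, x0)), f w != 0 by exact: H.
  case: H => -[A B] /= [At By] AB; exists (A, B) => //= -[t' z] /= [At' Bz].
  by have := AB (t', z) (conj At' Bz); rewrite /f /= subr_eq0.
near=> z => t t0.
have zT : forall t, `[0, T]%classic t -> z.1 != p + t *: z.2 by near: z.
have [tT|Tt] := lerP t T; first by apply: zT; rewrite /= in_itv/= t0.
apply/eqP => zE.
have z1 : `|z.1 - y0| < 1.
  near: z; apply: (@cvg_fst _ _ (nbhs y0) (nbhs x0) _ [set y | `|y - y0| < 1]).
  apply: open_nbhs_nbhs; split; last by rewrite /= subrr normr0.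
  exact: open_dist_lt.
have z2 : `|z.2 - x0| < `|x0| / 2.
  near: z; apply: (@cvg_snd _ _ (nbhs y0) (nbhs x0) _ [set y | `|y - x0| < `|x0| / 2]).
  apply: open_nbhs_nbhs; split; last by rewrite /= subrr normr0 divr_gt0.
  exact: open_dist_lt.
have z2' : `|x0| / 2 <= `|z.2|.
  have := ler_normB z.2 (z.2 - x0); rewrite opprB addrC subrK => h; lra.
have : t * (`|x0| / 2) <= `|y0 - p| + 1.
  apply: (@le_trans _ _ (t * `|z.2|)); first by rewrite ler_wpM2l.
  rewrite -[t in t * _]ger0_norm// -normrZ.
  have -> : t *: z.2 = (z.1 - y0) + (y0 - p) by rewrite zE addrA subrK addrC addKr.
  apply: (le_trans (ler_normD _ _)); lra.
by rewrite -ler_pdivlMr ?divr_gt0// leNgt Tt.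
Unshelve. all: by end_near. Qed.

Lemma enormZ (c : R) (x : V) : enorm (c *: x) = `|c| * enorm x.
Proof.
rewrite /enorm; under eq_bigr do rewrite mxE exprMn.
by rewrite -mulr_sumr sqrtrM ?sqr_ge0// sqrtr_sqr.
Qed.

Lemma enorm_gt0 (x : V) : x != 0 -> 0 < enorm x.
Proof.
move=> x0; have S0 : 0 <= \sum_(i < n) x 0 i ^+ 2 by apply: sumr_ge0 => i _; exact: sqr_ge0.
rewrite sqrtr_gt0 lt_neqAle S0 andbT eq_sym psumr_eq0; last by move=> i _; exact: sqr_ge0.
apply: contra x0 => /allP h; apply/eqP/rowP => i; rewrite mxE.
by apply/eqP; have := h i (mem_index_enum i); rewrite sqrf_eq0.
Qed.

Lemma continuous_enorm : continuous (@enorm R n).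
Proof.
move=> x; apply: (@continuous_comp _ _ _ (fun x : V => \sum_(i < n) x 0 i ^+ 2) Num.sqrt); last exact: sqrt_continuous.
suff : forall r : seq 'I_n, continuous (fun x : V => \sum_(i <- r) x 0 i ^+ 2) by apply.
elim=> [|i r IH]; first by under eq_fun do rewrite big_nil; exact: cst_continuous.
have sq : continuous (fun x : V => x 0 i ^+ 2).
  move=> z; apply: (@continuous_comp _ _ _ (fun x : V => x 0 i) (fun t : R => t ^+ 2)).
    exact: coord_continuous.
  exact: exprn_continuous.
have -> : (fun x : V => \sum_(k <- i :: r) x 0 k ^+ 2) =
    fun x : V => x 0 i ^+ 2 + \sum_(k <- r) x 0 k ^+ 2.
  by apply/funext => z; rewrite big_cons.
move=> z; apply: (@cvgD R R V (nbhs z) _ (fun x : V => x 0 i ^+ 2)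
  (fun x : V => \sum_(k <- r) x 0 k ^+ 2)); [exact: sq|exact: IH].
Qed.

Lemma cone_nbhs (L O : set V) (w : V) t0 : open O -> L = O `&` unit_sphere ->
  L w -> 0 < t0 -> nbhs (t0 *: w) (cone L).
Proof.
move=> oO LE; rewrite LE => -[Ow w1] t00; rewrite /unit_sphere/= in w1.
have w0 : w != 0.
  apply/eqP => w0; move: w1; rewrite w0 -(scale0r (0 : V)) enormZ normr0 mul0r => /eqP.
  by rewrite eq_sym oner_eq0.
have x00 : t0 *: w != 0 by rewrite scaler_eq0 negb_or gt_eqF.
have ex0 := enorm_gt0 x00.
have cN : {for t0 *: w, continuous (fun x : V => (enorm x)^-1 *: x)}.
  apply: (@cvgZ _ _ _ (nbhs (t0 *: w))); last exact: cvg_id.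
  by apply: (@continuousV R V (@enorm R n)); [rewrite gt_eqF|exact: continuous_enorm].
have NO : \forall x \near t0 *: w, O ((enorm x)^-1 *: x).
  apply: cN; apply: open_nbhs_nbhs; split=> //.
  by rewrite /= enormZ w1 mulr1 gtr0_norm// scalerA mulVf ?gt_eqF// scale1r.
have N0 : \forall x \near t0 *: w, x != 0.
  by apply: (@open_nbhs_nbhs _ _ [set v : V | v != 0]); split=> //; exact: open_nonzero.
apply: filterS2 NO N0 => x Ox x0; split=> //; split=> //.
by rewrite /unit_sphere/= enormZ gtr0_norm ?invr_gt0 ?enorm_gt0// mulVf// gt_eqF// enorm_gt0.
Qed.

End geometry.

(** * Product test functions in the parameter and the direction *)

Section tensor_test_functions.
Context {R : realType} {n : nat}.
Local Notation V := 'rV[R]_n.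

Lemma integralC_real (D : set R) (f : R -> R) :
  integralC D (fun t => (f t)%:C%C) = (\int[lebesgue_measure]_(t in D) f t)%:C%C.
Proof.
rewrite /integralC /=; congr (_ +i* _)%C.
by rewrite /Rintegral integral0.
Qed.

Lemma beam_adjoint_tensor (I : set R) (a : R -> V) (b : R -> R) (g : V -> R) y :
  beam_adjoint 0 I a (fun z => (b z.1 * g z.2)%:C%C) y =
  (\int[lebesgue_measure]_(s in I) \int[lebesgue_measure]_(t in `]0, +oo[)
     (t^-1 ^+ n * (b s * g (t^-1 *: (y - a s)))))%:C%C.
Proof.
rewrite /beam_adjoint -integralC_real; congr integralC; apply/funext => s.
rewrite /=; under [X in integralC _ X]eq_fun do rewrite -rmorphM/=.
rewrite integralC_real; congr (_%:C)%C.
apply: eq_Rintegral => t _; congr (_ * _).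
by rewrite sub0r -exprnN exprVn.
Qed.

Lemma test_fun_tensor (I : set R) (C F : set V) s0 r (g : V -> R) :
  smooth g -> 0 < r -> (forall s, s0 - 2 * r <= s <= s0 + 2 * r -> I s) ->
  compact F -> F `<=` C -> (forall x, ~ F x -> g x = 0) ->
  test_fun (I `*` C) (fun z : R * V => (bump1 (r^-1 * (z.1 - s0)) * g z.2)%:C%C).
Proof.
move=> sg r0 HI cF FC g0.
have clF : closed F := compact_closed (@norm_hausdorff _ _) cF.
pose A : set (R * V) := `[s0 - 2 * r, s0 + 2 * r]%classic `*` F.
have cA : compact A by apply: compact_setX => //; exact: segment_compact.
have supA : fsupport (fun z : R * V => (bump1 (r^-1 * (z.1 - s0)) * g z.2)%:C%C) `<=` A.
  apply: fsupport_sub; first exact: compact_closed (@norm_hausdorff _ _) cA.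
  move=> [s x] nA /=; have [Fx|/g0 ->] := pselect (F x); last by rewrite mulr0.
  rewrite bump1_eq0 ?mul0r// normrM gtr0_norm ?invr_gt0// ler_pdivlMl// mulrC.
  rewrite leNgt; apply/negP; rewrite ltr_norml => /andP[h1 h2]; apply: nA; split=> //.
  by rewrite /= in_itv/=; lra.
split.
- apply/smooth_onP/smoothC_real/smoothM.
    apply: (@smooth_affine R _ R bump1 fst r^-1 s0) => //; last exact: smooth_bump1.
    by move=> z; exact: cvg_fst.
  rewrite (_ : (fun z : R * V => g z.2) = fun z => g (1 *: (z.2 - 0))).
    apply: (@smooth_affine R _ V g snd 1 0) => //.
    by move=> z; exact: cvg_snd.
  by apply/funext => z; rewrite subr0 scale1r.
- exact: subclosed_compact (@fsupport_closed _ _ _) cA supA.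
- move=> [s x] /supA[/= sr Fx]; split; last exact: FC.
  by apply: HI; move: sr; rewrite /= in_itv.
Qed.

End tensor_test_functions.

(** * Points on rays from the curve lie off the support of the distribution *)

Section support_theorem.
Context {R : realType} {n : nat}.
Local Notation V := 'rV[R]_n.
Variables (Lambda : set V) (I : set R) (a : R -> V) (U : set V) (mu : (V -> R[i]) -> R[i]).
Hypotheses (hLambda : exists2 O : set V, open O & Lambda = O `&` unit_sphere)
  (hI : open I) (hIint : is_interval I) (ha : C1_on I a)
  (hUo : open U) (hUA : U `&` (a @` I) = set0)
  (hmu : schwartz_distribution U mu) (cD : compact (dsupport U mu))
  (hD : vanishes_on (I `*` cone Lambda) (beam 0 I a U mu)).

(** The vanishing is carried from [s1], where the rays miss, to the given [s]; both must be interior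
    to one compact segment of parameters. *)
Lemma open_interval_around s s1 : I s -> I s1 -> exists j1 j2,
  [/\ j1 < s < j2, j1 < s1 < j2 & forall x, j1 <= x <= j2 -> I x].
Proof.
have around x : I x -> exists2 r, 0 < r & I (x - r) /\ I (x + r).
  move=> Ix; have /nbhs_ballP[e /= e0 He] : nbhs x I by exact: open_nbhs_nbhs.
  exists (e / 2); first by rewrite divr_gt0.
  split; apply: He; rewrite -ball_normE/=.
    by rewrite opprB addrC subrK gtr0_norm ?divr_gt0//; lra.
  by rewrite opprD addNKr normrN gtr0_norm ?divr_gt0//; lra.
move=> /around[r r0 [Is1 Is2]] /around[r' r'0 [Is1' Is2']].
exists (Num.min (s - r) (s1 - r')), (Num.max (s + r) (s1 + r')); split.
- by rewrite gt_min lt_max; apply/andP; split; apply/orP; left; lra.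
- by rewrite gt_min lt_max; apply/andP; split; apply/orP; right; lra.
- by apply: hIint; [case: leP|case: leP].
Qed.

Lemma ray_not_dsupport s s1 w t0 : I s -> I s1 -> Lambda w -> 0 < t0 ->
  ray (a s1) w `&` U = set0 -> ~ dsupport U mu (a s + t0 *: w).
Proof.
move=> Is Is1 Lw t00 missU.
set D := dsupport U mu; set x0 := t0 *: w.
have DU : D `<=` U by move=> x [].
have [mulin _] := hmu.
have [B oB LB] := hLambda.
have ncone : nbhs x0 (cone Lambda) := cone_nbhs oB LB Lw t00.
have x00 : x0 != 0 by have [] := nbhs_singleton ncone.
have nx0 : 0 < `|x0| by rewrite normr_gt0.
have missD y : D y -> forall t, 0 <= t -> y != a s1 + t *: x0.
  move=> /DU Uy t tge0; apply/eqP => yE.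
  have : (ray (a s1) w `&` U) y.
    by split=> //; exists (t * t0); [rewrite mulr_ge0// ltW|rewrite yE /x0 scalerA].
  by rewrite missU.
(* Each point of [D] tolerates a small change of direction; compactness of [D] makes this
   uniform. *)
have missN : \forall x \near x0, forall y, D y -> forall t, 0 <= t -> y != a s1 + t *: x.
  have /compact_near_coveringP cDn := cD.
  apply: (cDn V (nbhs x0) (fun x y => forall t, 0 <= t -> y != a s1 + t *: x)) => y Dy.
  exact: ray_avoid_near x00 (missD y Dy).
(* One ball serves three ends: it lies in the cone, so [hD] applies to test functions supported in
   it; rays from [a s1] through it miss [D]; and its points are bounded away from 0. *)
have [r r0 Fr] : exists2 r, 0 < r & cball x0 r `<=` [set x | cone Lambda x /\
    (forall y, D y -> forall t, 0 <= t -> y != a s1 + t *: x) /\ `|x0| / 2 <= `|x|].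
  have nN : \forall x \near x0, `|x0| / 2 <= `|x|.
    have : \forall x \near x0, `|x - x0| < `|x0| / 2.
      apply: (@open_nbhs_nbhs _ x0 [set x | `|x - x0| < `|x0| / 2]).
      by split; [exact: open_dist_lt|rewrite /= subrr normr0 divr_gt0].
    apply: filterS => x h; have := ler_normB x (x - x0); rewrite opprB addrC subrK => ?; lra.
  have : nbhs x0 [set x | cone Lambda x /\
      (forall y, D y -> forall t, 0 <= t -> y != a s1 + t *: x) /\ `|x0| / 2 <= `|x|].
    exact: filterI ncone (filterI missN nN).
  move=> /nbhs_ballP[e /= e0 He].
  exists (e / 2); first by rewrite divr_gt0.
  by move=> x; rewrite /cball/= => xe; apply: He; rewrite -ball_normE/= distrC; lra.
set F := cball x0 r in Fr.
have cF : compact F by exact: cball_compact.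
have clF : closed F by exact: cball_closed.
have F0 x : F x -> x != 0 by move=> /Fr[[]].
have c10 : 0 < `|x0| / 2 by rewrite divr_gt0.
have Fc x : F x -> `|x0| / 2 <= `|x| <= `|x0| + r.
  move=> Fx; have [_ [_ ->]] := Fr x Fx.
  rewrite -[x in `|x|](subrK x0); apply: (le_trans (ler_normD _ _)).
  by rewrite addrC lerD2l; exact: Fx.
have [j1 [j2 [sj s1j jI]]] := open_interval_around Is Is1.
have j12 : j1 < j2 by case/andP: sj => ? ?; apply: (@lt_trans _ _ s).
have aC1 x : j1 <= x <= j2 -> derivable a x 1 /\ {for x, continuous (derive1 a)}.
  by move=> /jI /ha.
pose chi := xget (fun=> 0 : R[i]) (cutoff U mu).
have [tchi chi1] : cutoff U mu chi := xgetPex _ (cutoff_exists hUo cD).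
set K := fsupport chi.
have [_ cK KU] := tchi.
have Ka y x : K y -> j1 <= x <= j2 -> y != a x.
  move=> /KU Uy /jI Ix; apply/eqP => yE.
  have : (U `&` a @` I) y by split=> //; exists x.
  by rewrite hUA.
have beam0 (part : R[i] -> R) :
  (forall z w, part (z + w) = part z + part w) ->
  (forall (c : R) z, part (c%:C%C * z) = c * part z) ->
  (forall z, `|part z| <= Normc.normc z) ->
  forall g, smooth g -> (forall x, ~ F x -> g x = 0) ->
    part (mu (fun y => chi y * (g (y - a s))%:C%C)) = 0.
  move=> partD partZ part_le g sg g0.
  have part0 : part 0 = 0.
    by have := partZ 0 0; rewrite mulr0 mul0r.
  have LamP := dist_functional hmu tchi partD partZ part_le.
  apply: (beam_uniqueness j12 aC1 cK LamP Ka c10 Fc clF s1j _ _ sg g0 sj).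
  - move=> u su Hu; rewrite (dist_near_eq0 hmu tchi su)// => x Dx.
    (* [u] has to vanish near each point of [D], not just on [D]; compactness of [F] gives a
       neighbourhood avoided by all the rays at once. *)
    have /compact_near_coveringP cFn := cF.
    have avoid : \forall y \near x, F `<=` fun z => forall t, 0 <= t -> y != a s1 + t *: z.
      apply: (cFn V (nbhs x) (fun y z => forall t, 0 <= t -> y != a s1 + t *: z)) => z Fz.
      have [_ [missz _]] := Fr z Fz.
      have [[A A'] /= [Ax A'z] AA] := ray_avoid_near (F0 z Fz) (missz x Dx).
      by exists (A', A) => //= -[z' y'] /= [? ?]; exact: (AA (y', z')).
    apply: filterS avoid => y Hy; apply: Hu => t tgt0 Ft.
    have /eqP := Hy _ Ft t (ltW tgt0); apply.
    by rewrite scalerA mulfV ?gt_eqF// scale1r addrC subrK.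
  - move=> h s0 r' sh h0 r'0 js0 s0j u su uE.
    have HI x : s0 - 2 * r' <= x <= s0 + 2 * r' -> I x.
      by move=> /andP[? ?]; apply: jI; lra.
    have FC : F `<=` cone Lambda by move=> x /Fr[].
    have := hD (test_fun_tensor sh r'0 HI cF FC h0).
    rewrite /beam /pairing -/chi.
    rewrite (_ : (fun y => chi y * beam_adjoint _ _ _ _ y) = fun y => chi y * (u y)%:C%C).
      by move=> ->.
    apply/funext => y; have [Ky|/fsupport_eq0 ->] := pselect (K y); last by rewrite !mul0r.
    congr (_ * _).
    rewrite (beam_adjoint_tensor I a (fun x => bump1 (r'^-1 * (x - s0))) h y).
    congr (_%:C)%C; rewrite uE//.
    apply: eq_Rintegral_supp => x /=; rewrite in_itv/=.
    + by [].
    + move=> Ix nx; rewrite (_ : (fun t => _) = fun=> 0) /Rintegral ?integral0//.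
      apply/funext => t; rewrite bump1_eq0 ?mul0r ?mulr0//.
      rewrite normrM gtr0_norm ?invr_gt0// ler_pdivlMl// mulrC leNgt; apply/negP.
      by rewrite ltr_norml => /andP[? ?]; apply: nx; lra.
    + by move=> /HI.
have chiF g : smooth g -> (forall x, ~ F x -> g x = 0) ->
    mu (fun y => chi y * (g (y - a s))%:C%C) = 0.
  move=> sg g0; apply/eqP; rewrite eq_complex/=; apply/andP; split; apply/eqP.
    apply: (beam0 (@complex.Re R)) => //; [exact: complex_ReD| |exact: Re_normc].
    by move=> c z; rewrite complex_ReM/= mul0r subr0.
  apply: (beam0 (@complex.Im R)) => //; [exact: complex_ImD| |exact: Im_normc].
  by move=> c z; rewrite complex_ImM/= mul0r addr0.
move=> [Ux]; apply.
(* This is the open ball of [F] translated by [a s]; functions supported in it, moved back, vanish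
   off [F]. *)
exists (U `&` [set y | `|y - (a s + x0)| < r]); split.
- by apply: openI => //; exact: open_dist_lt.
- by move=> y [].
- by split=> //=; rewrite subrr normr0.
move=> f tf; have [/smooth_onP[sf1 sf2] cf fO] := tf.
have tfU : test_fun U f by split; [exact/smooth_onP|exact: cf|move=> y /fO[]].
have f0 y : ~ F (y - a s) -> f y = 0.
  move=> nF; apply: fsupport_eq0 => /fO[_ /= yr]; apply: nF.
  by rewrite /F /cball/= -addrA -opprD ltW.
have shift (u : V -> R) : smooth u -> smooth (fun z => u (z + a s)).
  move=> su; rewrite (_ : (fun z => _) = fun z => u (1 *: (z - (- a s)))).
    exact: smooth_dilate.
  by apply/funext => z; rewrite opprK scale1r.
have part_eq0 (part : R[i] -> R) : part 0 = 0 -> smooth (fun y => part (f y)) ->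
    mu (fun y => chi y * (part (f y))%:C%C) = 0.
  move=> part0 spart.
  have -> : (fun y => chi y * (part (f y))%:C%C) =
      fun y => chi y * (part (f (y - a s + a s)))%:C%C.
    by apply/funext => y; rewrite subrK.
  apply: (chiF (fun z => part (f (z + a s))) (shift _ spart)) => z nFz.
  by rewrite f0 ?part0// addrK.
have schi : smoothC chi by have [/smooth_onP] := tchi.
have sf : smoothC f by [].
have s1chi : smoothC (fun y => 1 - chi y).
  have [h1 h2] := schi; split.
    have -> : (fun y => complex.Re (1 - chi y)) = fun y => 1 - complex.Re (chi y).
      by apply/funext => y; case: (chi y).
    by apply: smoothB => //; exact: smooth_cst.
  have -> : (fun y => complex.Im (1 - chi y)) = fun y => - complex.Im (chi y).
    by apply/funext => y; case: (chi y) => ? ?; rewrite /= sub0r.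
  exact: smoothN.
(* The first summand vanishes near the support of [mu], where [chi] is 1, so [mu] sees only
   [chi * f]. *)
rewrite (_ : f = fun y => f y * (1 - chi y) + chi y * f y); last first.
  by apply/funext => y; rewrite mulrBr mulr1 [chi y * _]mulrC subrK.
have tchif : test_fun U (fun y => chi y * f y) by exact: test_fun_mul.
have tfchi : test_fun U (fun y => f y * (1 - chi y)) by exact: test_fun_mul.
rewrite (distD mulin tfchi tchif) (dist_eq0 mulin tfchi); last first.
  move=> y + Dy => /(_ _ (chi1 y Dy))[z [/= /eqP nz chiz]].
  by apply: nz; rewrite chiz subrr mulr0.
rewrite add0r (_ : (fun y => _) = fun y => 'i%C * (chi y * (complex.Im (f y))%:C%C) +
    chi y * (complex.Re (f y))%:C%C).
  rewrite mulin; first by rewrite !part_eq0// mulr0 addr0.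
  - by apply: test_fun_mul => //; exact: smoothC_real.
  - by apply: test_fun_mul => //; exact: smoothC_real.
apply/funext => y; rewrite mulrCA -mulrDr; congr (_ * _).
by rewrite addrC {1}[f y]complexE mulrC.
Qed.

End support_theorem.

Theorem theorem4p3 (R : realType) (n : nat)
    (Lambda : set 'rV[R]_n)
    (hLambda : exists2 O : set 'rV[R]_n, open O & Lambda = O `&` unit_sphere)
    (I : set R) (hI : open I) (hIint : is_interval I)
    (a : R -> 'rV[R]_n) (ha : C1_on I a)
    (U : set 'rV[R]_n) (hUb : bounded_set U) (hUo : open U)
    (hUA : U `&` (a @` I) = set0)
    (hmiss : forall w, Lambda w -> exists J : set R,
       [/\ open J, is_interval J, J !=set0, J `<=` I &
           forall s, J s -> ray (a s) w `&` U = set0])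
    (mu : ('rV[R]_n -> R[i]) -> R[i]) (hmu : compact_distribution U mu)
    (hD : vanishes_on (I `*` cone Lambda) (beam 0 I a U mu)) :
  vanishes_on (U `&` measured_region (a @` I) Lambda) mu.
Proof.
move: hmu => [hs cD] f tf; have [mulin _] := hs; have [sf cf fU] := tf.
have tfU : test_fun U f by split=> // x /fU[].
apply: (dist_eq0 mulin tfU) => x /fU[Ux [v [w [[s Is <-] Lw [t t0 xE]]]]].
(* [t = 0] would put [x] on the curve, which [U] avoids; the cone needs a positive multiple of
   [w]. *)
have {}t0 : 0 < t.
  rewrite lt_neqAle t0 andbT; apply/eqP => t0E.
  have : (U `&` a @` I) x by split=> //; exists s; rewrite // xE -t0E scale0r addr0.
  by rewrite hUA.
have [J [_ _ [s1 Js1] JI missJ]] := hmiss w Lw.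
rewrite xE; apply: (ray_not_dsupport hLambda hI hIint ha hUo hUA hs cD hD Is (JI _ Js1) Lw t0).
exact: missJ.
Qed.
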